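(* In the setting below, the field $\mathfrak R_\theta=k(\sqrt[3]{\pi_1},\sqrt[3]{\pi_2},\sqrt[3]{\theta})$ is independent of the choice of admissible $\theta\in\mathcal O_{K_1}$: if $\theta,\theta'$ are both admissible then $\mathfrak R_\theta=\mathfrak R_{\theta'}$.
   Context: $k=\mathbb Q(\zeta_3)$, $\zeta_3=\frac{-1+\sqrt{-3}}{2}$, $\mathcal O_k=\mathbb Z[\zeta_3]$. Let $\mathfrak p_1,\mathfrak p_2$ be distinct finite primes of $k$ not above $3$ with $\mathrm N\mathfrak p_i\equiv1\bmod9$, and $\pi_i\in\mathcal O_k$ the unique generators of $\mathfrak p_i$ with $\pi_i\equiv1\bmod(3\sqrt{-3})$. Assume $\pi_1$ is a cube in $k_{\mathfrak p_2}^\times$ and $\pi_2$ is a cube in $k_{\mathfrak p_1}^\times$. Let $K_1=k(\sqrt[3]{\pi_1})$ and $\tau\in\mathrm{Gal}(K_1/k)$ with $\tau(\sqrt[3]{\pi_1})=\zeta_3\sqrt[3]{\pi_1}$. Fix a prime $\mathfrak P$ of $K_1$ over $\mathfrak p_2$. Call $\theta\in\mathcal O_{K_1}$ admissible if $\theta=\zeta_3^c\,\alpha^2\tau(\alpha)$ for some $c\in\{0,1,2\}$ and some $\alpha\in\mathcal O_{K_1}$ with $\mathrm N_{K_1/k}(\alpha)=\pi_2\beta^3$ for some $\beta\in k$ and $(\alpha)=\mathfrak P^a\mathfrak B^b$ with $3\nmid a$, $\mathfrak B$ an ideal coprime to $3$, $3\mid b$; and moreover there exists $\eta\in\mathcal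 O_{K_1}$ with $\eta^3\equiv\theta\bmod(3\sqrt{-3})\mathcal O_{K_1}$. *)

(* Defs.v *)
From mathcomp Require Import all_boot all_order all_algebra all_field.
Import Order.TTheory GRing.Theory Num.Theory.
Set Implicit Arguments. Unset Strict Implicit. Unset Printing Implicit Defensive.
Local Open Scope ring_scope.

Definition sqrtm3 : algC := 'i * sqrtC 3.
Definition zeta3 : algC := (-1 + sqrtm3) / 2.

Definition in_k (x : algC) : Prop := exists a b : rat, x = ratr a + ratr b * zeta3.
Definition in_Ok (x : algC) : Prop := in_k x /\ x \in Aint.
Definition dvd_Ok (x y : algC) : Prop := exists z, in_Ok z /\ y = x * z.

Definition prime_Ok (p : algC) : Prop :=
  [/\ in_Ok p, p != 0, ~ dvd_Ok p 1 &
      forall x y, in_Ok x -> in_Ok y -> dvd_Ok p (x * y) -> dvd_Ok p x \/ dvd_Ok p y].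

Definition norm_1_mod9 (p : algC) : Prop :=
  exists n : int, p * p^* = n%:~R /\ (n %% 9)%Z = 1.

Definition primary (p : algC) : Prop := dvd_Ok (3 * sqrtm3) (p - 1).

(* v_p(a) >= n  for a in k, p a prime element of O_k *)
Definition vge (p : algC) (n : nat) (a : algC) : Prop :=
  exists b c, [/\ in_Ok b, in_Ok c, ~ dvd_Ok p c & a * c = p ^+ n * b].

(* x (nonzero, in k) is a cube in the completion k_p: x lies in the p-adic
   closure of the cubes of k (k is dense in k_p). *)
Definition cube_in_completion (p x : algC) : Prop :=
  forall n : nat, exists y, in_k y /\ vge p n (y ^+ 3 - x).

Definition in_K1 (r1 x : algC) : Prop :=
  exists a b c, [/\ in_k a, in_k b, in_k c & x = a + b * r1 + c * r1 ^+ 2].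
Definition in_OK1 (r1 x : algC) : Prop := in_K1 r1 x /\ x \in Aint.

Definition ideal (r1 : algC) (I : algC -> Prop) : Prop :=
  [/\ forall x, I x -> in_OK1 r1 x, I 0,
      forall x y, I x -> I y -> I (x + y) &
      forall x y, in_OK1 r1 x -> I y -> I (x * y)].
Definition ideal_mul (r1 : algC) (I J : algC -> Prop) : algC -> Prop :=
  fun x => forall L, ideal r1 L -> (forall i j, I i -> J j -> L (i * j)) -> L x.
Fixpoint ideal_pow (r1 : algC) (I : algC -> Prop) (n : nat) : algC -> Prop :=
  match n with
  | 0 => in_OK1 r1
  | n'.+1 => ideal_mul r1 (ideal_pow r1 I n') I
  end.
Definition principal (r1 a : algC) : algC -> Prop :=
  fun x => exists y, in_OK1 r1 y /\ x = a * y.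
Definition ideal_eq (I J : algC -> Prop) : Prop := forall x, I x <-> J x.
Definition prime_ideal (r1 : algC) (P : algC -> Prop) : Prop :=
  [/\ ideal r1 P, ~ P 1 &
      forall x y, in_OK1 r1 x -> in_OK1 r1 y -> P (x * y) -> P x \/ P y].
Definition coprime_to_3 (r1 : algC) (B : algC -> Prop) : Prop :=
  exists b c, [/\ B b, in_OK1 r1 c & 1 = b + 3 * c].

(* tau in Gal(K_1/k) with tau(r1) = zeta3 r1 (given by its action on K_1) *)
Definition is_tau (r1 : algC) (tau : algC -> algC) : Prop :=
  [/\ forall x y, in_K1 r1 x -> in_K1 r1 y -> tau (x + y) = tau x + tau y,
      forall x y, in_K1 r1 x -> in_K1 r1 y -> tau (x * y) = tau x * tau y,
      forall x, in_k x -> tau x = x &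
      tau r1 = zeta3 * r1].

Definition admissible (r1 pi2 : algC) (tau : algC -> algC) (P : algC -> Prop)
  (theta : algC) : Prop :=
  in_OK1 r1 theta /\
  (exists (c : nat) (alpha : algC),
     [/\ (c < 3)%N, in_OK1 r1 alpha,
         theta = zeta3 ^+ c * alpha ^+ 2 * tau alpha,
         (exists beta, [/\ in_k beta, beta != 0 &
             alpha * tau alpha * tau (tau alpha) = pi2 * beta ^+ 3]) &
         (exists (a b : nat) (B : algC -> Prop),
             [/\ ideal r1 B, coprime_to_3 r1 B, ~~ (3 %| a)%N, (3 %| b)%N &
                 ideal_eq (principal r1 alpha)
                          (ideal_mul r1 (ideal_pow r1 P a) (ideal_pow r1 B b))])]) /\
  (exists eta z, [/\ in_OK1 r1 eta, in_OK1 r1 z & eta ^+ 3 - theta = 3 * sqrtm3 * z]).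

Definition subfield (S : algC -> Prop) : Prop :=
  [/\ S 1, forall x y, S x -> S y -> S (x - y),
      forall x y, S x -> S y -> S (x * y) & forall x, S x -> S x^-1].
Definition gen_field (gs : seq algC) (x : algC) : Prop :=
  forall S, subfield S -> (forall g, g \in gs -> S g) -> S x.

(* Main.v *)
Require Import Defs.
From mathcomp Require Import all_boot all_order all_algebra all_field.
From mathcomp Require Import ring lra zify.
From mathcomp Require boolp classical_sets.
Import GRing.Theory Num.Theory.
Local Open Scope ring_scope.

(* Two admissible elements satisfy [theta ^+ 2 * theta' = w ^+ 3] for some [w] in [K1], so already
   [K1 (t) = K1 (t')]. Indeed [alpha' / alpha] has as norm a cube [b ^+ 3] of [k], hence
   [alpha' / alpha = b d / tau d] by Hilbert 90, and as [tau ^ 2 + tau + 1 = (tau - 1) ^ 2] modulo 3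
   this gives [theta ^+ 2 * theta' = m w ^+ 3] with [m = zeta3 ^ e / N d] in [k]. For every prime [q]
   of [k] not dividing [pi1] there is a prime [Q] of [K1] above [q] different from [P] and [tau P]
   (as [pi2] splits in [K1]); at [Q] the valuations of [theta] and [theta'] are divisible by 3 and
   [q] is unramified, so [3] divides the valuation of [m] at [q]. Since [pi1] is a cube in [K1] and
   [O_k] is principal, [m] may be taken to be a power of [zeta3]. Finally [theta] and [theta'] are
   units and cubes modulo [3 sqrt(-3)], where [zeta3] is not a cube, so [m = 1]. *)

(** * The ring of Eisenstein integers *)

(** Up to cubes of ideals an admissible [theta] generates [P ^ (2 a) tau(P) ^ a], so its valuation
    may fail to be divisible by 3 at [P] and [tau P], but not at the third conjugate. One good prime
    above [q] suffices because [m] lies in [k]: when [q] is unramified, the valuation of [m] at [q]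
    can be read at any prime above [q]. Valuations are built by hand: [q] itself is a uniformizer at
    [Q], and [x] is compared with [q ^+ n] through fractions of elements outside [Q]. The prime
    [sqrt(-3)] is the delicate one, since the discriminant of the powers of [r1] is divisible by 3.
    There the primary condition on [pi1] supplies a better integer, [omega = (r1 - 1) / sqrt(-3)].
    Unramifiedness at [sqrt(-3)] is used a second time at the very end, to exclude a nontrivial
    power of [zeta3]. *)

Lemma sqrtm3_sqr : sqrtm3 ^+ 2 = -3.
Proof. by rewrite /sqrtm3 exprMn sqrCi sqrtCK mulN1r. Qed.

Lemma sqrtm3E : sqrtm3 = 1 + 2 * zeta3.
Proof.
by rewrite /zeta3; field.
Qed.

Lemma zeta3_sqr : zeta3 ^+ 2 = -1 - zeta3.
Proof.
by have h := sqrtm3_sqr; rewrite /zeta3; field: h.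
Qed.

Lemma zeta3_cube : zeta3 ^+ 3 = 1.
Proof. have h := zeta3_sqr; ring: h. Qed.

Lemma zeta3_neq0 : zeta3 != 0.
Proof. by apply/eqP => h; have := zeta3_cube; rewrite h expr0n => /esym/eqP; rewrite oner_eq0. Qed.

Lemma sqrtm3_neq0 : sqrtm3 != 0.
Proof.
apply/eqP => h; have := sqrtm3_sqr; rewrite h expr0n => /esym/eqP.
by rewrite oppr_eq0 pnatr_eq0.
Qed.

Lemma conj_zeta3 : zeta3^* = -1 - zeta3.
Proof.
have sR : (sqrtC 3 : algC)^* = sqrtC 3.
  by apply: conj_Creal; rewrite ger0_real // sqrtC_ge0 ler0n.
rewrite /zeta3 /sqrtm3 rmorphM fmorphV rmorph_nat rmorphD rmorphN rmorph1 rmorphM /=.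
by rewrite sR conjCi; field.
Qed.

Lemma in_k_rat (a : rat) : in_k (ratr a).
Proof. by exists a, 0; rewrite rmorph0 mul0r addr0. Qed.

Lemma in_k_int (n : int) : in_k n%:~R.
Proof. by rewrite -(ratr_int _ n); exact: in_k_rat. Qed.

Lemma in_k_nat (n : nat) : in_k n%:R.
Proof. exact: (in_k_int n). Qed.

Lemma in_k0 : in_k 0. Proof. exact: (in_k_nat 0). Qed.
Lemma in_k1 : in_k 1. Proof. exact: (in_k_nat 1). Qed.

Lemma in_k_zeta3 : in_k zeta3.
Proof. by exists 0, 1; rewrite rmorph0 rmorph1 mul1r add0r. Qed.

Lemma in_kD {x y} : in_k x -> in_k y -> in_k (x + y).
Proof.
by case=> a [b ->] [c [d ->]]; exists (a + c), (b + d); rewrite !rmorphD /=; ring.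
Qed.

Lemma in_kN {x} : in_k x -> in_k (- x).
Proof. by case=> a [b ->]; exists (- a), (- b); rewrite !rmorphN /=; ring. Qed.

Lemma in_kM {x y} : in_k x -> in_k y -> in_k (x * y).
Proof.
case=> a [b ->] [c [d ->]]; exists (a * c - b * d), (a * d + b * c - b * d).
rewrite !(rmorphD, rmorphN, rmorphM) /=; have h := zeta3_sqr; ring: h.
Qed.

Lemma in_kX {x} n : in_k x -> in_k (x ^+ n).
Proof.
by move=> hx; elim: n => [|n IH]; [exact: in_k1 | rewrite exprS; apply: in_kM].
Qed.

Lemma conj_ratr (a : rat) : (ratr a : algC)^* = ratr a.
Proof. by apply: conj_Crat; exact: Crat_rat. Qed.

Lemma conj_k (a b : rat) : (ratr a + ratr b * zeta3)^* = ratr a + ratr b * (-1 - zeta3) :> algC.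
Proof. by rewrite rmorphD [X in _ + X]rmorphM /= !conj_ratr conj_zeta3. Qed.

Lemma in_k_conj {x} : in_k x -> in_k x^*.
Proof.
case=> a [b ->]; rewrite conj_k.
exists (a - b), (- b); rewrite !(rmorphD, rmorphN) /=; ring.
Qed.

Lemma in_k_norm {x} : in_k x -> exists a, x * x^* = ratr a.
Proof.
case=> a [b ->]; rewrite conj_k.
exists (a ^+ 2 - a * b + b ^+ 2); rewrite !(rmorphD, rmorphN, rmorphM, rmorphXn) /=.
have h := zeta3_sqr; ring: h.
Qed.

Lemma in_kV {x} : in_k x -> in_k x^-1.
Proof.
move=> hx; have [->|x0] := eqVneq x 0; first by rewrite invr0; exact: in_k0.
have [a ha] := in_k_norm hx.
have -> : x^-1 = x^* * (ratr a)^-1.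
  by rewrite -ha invfM mulrCA divff ?mulr1 // conjC_eq0.
by apply: in_kM; [exact: in_k_conj | rewrite -fmorphV; exact: in_k_rat].
Qed.

Lemma Aint_zeta3 : zeta3 \in Aint.
Proof. by apply: (@Aint_unity_root 3) => //; apply/unity_rootP; exact: zeta3_cube. Qed.

Lemma Aint_cube x : x ^+ 3 \in Aint -> x \in Aint.
Proof.
move=> hx; pose p : {poly algC} := minCpoly (x ^+ 3) \Po 'X^3.
apply: (@root_monic_Aint p).
- by rewrite /root horner_comp hornerXn; exact: root_minCpoly.
- rewrite monicE lead_coef_comp ?size_polyXn // lead_coefXn expr1n mulr1.
  exact: minCpoly_monic.
- rewrite polyOver_comp //; apply/polyOverP => i; rewrite coefXn.
  by case: (i == _); rewrite ?rpred0 ?rpred1.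
Qed.

Lemma in_Ok_int (n : int) : in_Ok n%:~R.
Proof. by split; [exact: in_k_int | exact: Aint_int]. Qed.
Lemma in_Ok_nat (n : nat) : in_Ok n%:R. Proof. exact: (in_Ok_int n). Qed.
Lemma in_Ok0 : in_Ok 0. Proof. exact: (in_Ok_nat 0). Qed.
Lemma in_Ok1 : in_Ok 1. Proof. exact: (in_Ok_nat 1). Qed.
Lemma in_Ok_zeta3 : in_Ok zeta3.
Proof. by split; [exact: in_k_zeta3 | exact: Aint_zeta3]. Qed.
Lemma in_OkD {x y} : in_Ok x -> in_Ok y -> in_Ok (x + y).
Proof. by case=> ? ? [? ?]; split; [exact: in_kD | exact: rpredD]. Qed.
Lemma in_OkN {x} : in_Ok x -> in_Ok (- x).
Proof. by case=> ? ?; split; [exact: in_kN | rewrite rpredN]. Qed.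
Lemma in_OkM {x y} : in_Ok x -> in_Ok y -> in_Ok (x * y).
Proof. by case=> ? ? [? ?]; split; [exact: in_kM | exact: rpredM]. Qed.
Lemma in_OkX {x} n : in_Ok x -> in_Ok (x ^+ n).
Proof. by case=> ? ?; split; [exact: in_kX | exact: rpredX]. Qed.
Lemma in_Ok_conj {x} : in_Ok x -> in_Ok x^*.
Proof. by case=> ? ?; split; [exact: in_k_conj | rewrite Aint_aut]. Qed.

Lemma in_Ok_sqrtm3 : in_Ok sqrtm3.
Proof.
rewrite sqrtm3E; apply: in_OkD; first exact: in_Ok1.
by apply: in_OkM; [exact: in_Ok_nat | exact: in_Ok_zeta3].
Qed.

Ltac okc := repeat first [ assumption | apply: in_Ok1 | apply: in_Ok0 | apply: in_Ok_zeta3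
  | apply: in_Ok_sqrtm3 | apply: in_Ok_nat | apply: in_OkN | apply: in_OkD | apply: in_OkM
  | apply: in_OkX ].

Lemma Aint_ratr (r : rat) : (ratr r : algC) \in Aint -> exists n : int, r = n%:~R.
Proof.
move=> /(Cint_rat_Aint (Crat_rat r)) /intrP[n hn]; exists n.
by apply/eqP; rewrite -(fmorph_eq (ratr : {rmorphism rat -> algC})) /= hn ratr_int.
Qed.

(* Subtracting from [x = a + b zeta3] its conjugate, [b sqrt(-3)] is integral, so [3 b] and [3 b^2] are. *)
Lemma in_OkP x : in_Ok x -> exists a b : int, x = a%:~R + b%:~R * zeta3.
Proof.
move=> hx; have [[a [b hab]] xA] := hx.
have hbs : x - x^* = ratr b * sqrtm3.
  by rewrite hab conj_k sqrtm3E; ring.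
have hbsA : ratr b * sqrtm3 \in Aint.
  by rewrite -hbs; apply: (in_OkD hx (in_OkN (in_Ok_conj hx))).2.
have h3b : exists n : int, 3 * b = n%:~R.
  apply: Aint_ratr; have -> : ratr (3 * b) = - (ratr b * sqrtm3 * sqrtm3) :> algC.
    rewrite rmorphM /= ratr_nat; have h := sqrtm3_sqr; ring: h.
  by rewrite rpredN rpredM // in_Ok_sqrtm3.2.
have hb2 : exists n : int, 3 * b ^+ 2 = n%:~R.
  apply: Aint_ratr; have -> : ratr (3 * b ^+ 2) = - (ratr b * sqrtm3) ^+ 2 :> algC.
    rewrite rmorphM rmorphXn /= ratr_nat; have h := sqrtm3_sqr; ring: h.
  by rewrite rpredN rpredX.
have [n hn] := h3b; have [n' hn'] := hb2.
(* With [n = 3 b], both bounds on the denominator combine to [3 | n ^ 2], hence [3 | n] by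
   inspection of remainders, and [b] is an integer. *)
have hnn : n ^+ 2 = 3 * n' :> int.
  apply/eqP; rewrite -(eqr_int rat) rmorphXn rmorphM /= -hn -hn'; apply/eqP; ring.
have [k hk] : exists k : int, n = 3 * k.
  exists (n %/ 3)%Z; have := divz_eq n 3; have : (0 <= n %% 3)%Z /\ (n %% 3 < 3)%Z by lia.
  have : (n %% 3)%Z ^+ 2 = 3 * (n' - 3 * (n %/ 3)%Z ^+ 2 - 2 * (n %/ 3)%Z * (n %% 3)%Z).
    have -> : (n %% 3)%Z = n - 3 * (n %/ 3)%Z by have := divz_eq n 3; lia.
    by move: hnn; rewrite !expr2; lia.
  move: (n %% 3)%Z (n' - _ - _) => r s hr [r0 r3] hh.
  have : r = 0 \/ r = 1 \/ r = 2 by lia.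
  by case=> [?|[?|?]]; subst r; lia.
have hb : b = k%:~R.
  have : 3 * b = 3 * k%:~R by rewrite hn hk rmorphM.
  by move/(mulfI _); apply.
have hae : ratr a = x - k%:~R * zeta3 :> algC by rewrite hab hb ratr_int; ring.
have aA : (ratr a : algC) \in Aint.
  by rewrite hae; apply: (in_OkD hx (in_OkN (in_OkM (in_Ok_int k) in_Ok_zeta3))).2.
have [j hj] := Aint_ratr _ aA.
by exists j, k; rewrite hab hj hb !ratr_int.
Qed.

(** A natural number, so that it can serve as a measure for induction; on [O_k] the truncation loses
    nothing ([normkE]). *)
Definition normk (x : algC) : nat := Num.truncn (x * x^*).

Lemma normkE {x} : in_Ok x -> x * x^* = (normk x)%:R.
Proof.
move=> hx; apply/esym/truncnK; rewrite natrEint mul_conjC_ge0 andbT.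
have [a ha] := in_k_norm hx.1; apply: Cint_rat_Aint; first by rewrite ha Crat_rat.
exact: (in_OkM hx (in_Ok_conj hx)).2.
Qed.

Lemma normkM x y : in_Ok x -> in_Ok y -> normk (x * y) = (normk x * normk y)%N.
Proof.
move=> hx hy; apply/eqP; rewrite -(eqr_nat algC) natrM -!normkE //; last exact: in_OkM.
by rewrite rmorphM /=; apply/eqP; ring.
Qed.

Lemma normk_eq0 x : in_Ok x -> (normk x == 0%N) = (x == 0).
Proof. by move=> hx; rewrite -(eqr_nat algC) -normkE // mulf_eq0 conjC_eq0 orbb. Qed.

Lemma normk1_unit {x} : in_Ok x -> normk x = 1%N -> dvd_Ok x 1.
Proof. by move=> hx h; exists x^*; split; [exact: in_Ok_conj | rewrite normkE // h]. Qed.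

Lemma normk1 : normk 1 = 1%N.
Proof. by rewrite /normk rmorph1 mulr1 truncn1. Qed.

Lemma dvd_Ok_normk {x y} : in_Ok x -> in_Ok y -> y != 0 -> dvd_Ok x y -> (normk x <= normk y)%N.
Proof.
move=> hx hy y0 [z [hz e]]; have z0 : z != 0 by apply: contraNneq y0 => z0; rewrite e z0 mulr0.
by rewrite e normkM // leq_pmulr // lt0n normk_eq0.
Qed.

Lemma dvd_OkD {x y z} : dvd_Ok x y -> dvd_Ok x z -> dvd_Ok x (y + z).
Proof. by case=> u [? ->] [v [? ->]]; exists (u + v); split; [okc | ring]. Qed.

Lemma dvd_OkMl {x y} z : in_Ok z -> dvd_Ok x y -> dvd_Ok x (z * y).
Proof. by move=> hz [u [? ->]]; exists (z * u); split; [okc | ring]. Qed.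

Lemma dvd_Ok_refl x : dvd_Ok x x.
Proof. by exists 1; split; [okc | rewrite mulr1]. Qed.

Lemma dvd_Ok_trans {x y z} : dvd_Ok x y -> dvd_Ok y z -> dvd_Ok x z.
Proof. by case=> u [? ->] [v [? ->]]; exists (u * v); split; [okc | ring]. Qed.

Lemma round_rat (a : rat) : exists m : int, `|a - m%:~R| <= 1 / 2.
Proof.
exists (Num.floor (a + 1 / 2)); have /andP[h1 h2] := floor_itv (a + 1 / 2).
by move: h2; rewrite intrD ler_norml => h2; apply/andP; split; lra.
Qed.

(** Round both coordinates of [x / y]: the errors [e], [f] are at most 1/2 in absolute value, so
    [e ^ 2 - e f + f ^ 2 <= 3/4]. *)
Lemma Ok_euclid x y : in_Ok x -> in_Ok y -> y != 0 ->
  exists q, in_Ok q /\ (normk (x - q * y)%R < normk y)%N.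
Proof.
move=> hx hy y0; have [a [b hab]] := in_kM hx.1 (in_kV hy.1).
have [m hm] := round_rat a; have [n hn] := round_rat b.
pose q : algC := m%:~R + n%:~R * zeta3.
have hq : in_Ok q by apply: in_OkD; [|apply: in_OkM]; [exact: in_Ok_int|exact: in_Ok_int|okc].
exists q; split=> //.
have hr : in_Ok (x - q * y) by okc.
pose e := a - m%:~R; pose f := b - n%:~R.
have hxy : x - q * y = (ratr e + ratr f * zeta3) * y.
  have -> : x = (x / y) * y by rewrite mulfVK.
  rewrite hab /q /e /f !rmorphB /= !ratr_int; ring.
have hN : (normk (x - q * y))%:R = ratr (e ^+ 2 - e * f + f ^+ 2) * (normk y)%:R :> algC.
  rewrite -!normkE // hxy [(_ * y)^*]rmorphM /= conj_k !(rmorphD, rmorphN, rmorphM, rmorphXn) /=.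
  have h := zeta3_sqr; ring: h.
rewrite -(ltr_nat rat).
have -> : (normk (x - q * y))%:R = (e ^+ 2 - e * f + f ^+ 2) * (normk y)%:R :> rat.
  by apply: (fmorph_inj (@ratr algC)); rewrite rmorphM /= !ratr_nat hN.
have hy0 : 0 < (normk y)%:R :> rat by rewrite ltr0n lt0n normk_eq0.
rewrite gtr_pMl //.
move: hm hn; rewrite -/e -/f !ler_norml => /andP[? ?] /andP[? ?].
have : e ^+ 2 <= 1 / 4 by nra.
have : f ^+ 2 <= 1 / 4 by nra.
have : - (e * f) <= 1 / 4 by nra.
by lra.
Qed.

Lemma Ok_bezout x y : in_Ok x -> in_Ok y ->
  exists g u v, [/\ in_Ok u, in_Ok v, g = u * x + v * y, dvd_Ok g x & dvd_Ok g y].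
Proof.
move=> hx hy; have [n] := ubnP (normk y); elim: n x y hx hy => // n IH x y hx hy hn.
have [y0|y0] := eqVneq y 0.
  exists x, 1, 0; split; rewrite ?y0; okc; rewrite ?mul1r ?mulr0 ?addr0 //; first exact: dvd_Ok_refl.
  by exists 0; split; [okc | rewrite mulr0].
have [q [hq lt]] := Ok_euclid x y hx hy y0.
have hr : in_Ok (x - q * y) by okc.
have [g [u [v [hu hv hg d1 d2]]]] := IH y (x - q * y) hy hr (leq_trans lt hn).
exists g, v, (u - v * q); split; okc; first by rewrite hg; ring.
by rewrite -(subrK (q * y) x); apply: dvd_OkD => //; apply: dvd_OkMl.
Qed.

Lemma prime_bezout {q c} : prime_Ok q -> in_Ok c -> ~ dvd_Ok q c ->
  exists u v, [/\ in_Ok u, in_Ok v & 1 = u * q + v * c].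
Proof.
case=> hq q0 qn1 qp hc nqc; have [g [u [v [hu hv hg d1 d2]]]] := Ok_bezout q c hq hc.
have hgO : in_Ok g by rewrite hg; okc.
case: d1 => w [hw eq].
have : dvd_Ok q (g * w) by rewrite -eq; exact: dvd_Ok_refl.
case/qp => // [dqg|[w' [hw' ew]]].
  by case: nqc; apply: dvd_Ok_trans d2.
have g1 : 1 = g * w'.
  by apply: (mulfI q0); rewrite mulr1 {1}eq ew; ring.
exists (w' * u), (w' * v); split; okc; rewrite g1 hg; ring.
Qed.

(** Induction on the norm. If every divisor of [m] were a unit or a multiple of [m], then applying
    Bezout to [m] and [x] would make [m] prime; otherwise a proper divisor has smaller norm. *)
Lemma prime_Ok_factor m : in_Ok m -> m != 0 -> ~ dvd_Ok m 1 ->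
  exists q, prime_Ok q /\ dvd_Ok q m.
Proof.
have [n] := ubnP (normk m); elim: n m => // n IH m hn hm m0 m1.
have [hp|hnp] := boolp.EM (forall x y, in_Ok x -> in_Ok y -> dvd_Ok m (x * y) -> dvd_Ok m x \/ dvd_Ok m y).
  by exists m; split; [split | exact: dvd_Ok_refl].
have [d [hd dm d1 md]] : exists d, [/\ in_Ok d, dvd_Ok d m, ~ dvd_Ok d 1 & ~ dvd_Ok m d].
  apply: boolp.contrapT => hno; apply: hnp => x y hx hy mxy.
  have [g [u [v [hu hv hg d1 d2]]]] := Ok_bezout m x hm hx.
  have hgO : in_Ok g by rewrite hg; okc.
  have [[w [hw g1]]|g1] := boolp.EM (dvd_Ok g 1).
    right; rewrite -[y]mul1r g1 hg.
    have -> : (u * m + v * x) * w * y = u * w * y * m + v * w * (x * y) by ring.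
    by apply: dvd_OkD; apply: dvd_OkMl; okc; exact: dvd_Ok_refl.
  have [mg|mg] := boolp.EM (dvd_Ok m g); first by left; apply: dvd_Ok_trans d2.
  by case: hno; exists g.
have d0 : d != 0 by apply: contraNneq m0 => d0; case: dm => z [_ ->]; rewrite d0 mul0r.
case: (dm) => z [hz ez].
have z0 : z != 0 by apply: contraNneq m0 => z0; rewrite ez z0 mulr0.
have hz1 : (1 < normk z)%N.
  have : normk z != 0%N by rewrite normk_eq0.
  have : normk z <> 1%N.
    move=> /(normk1_unit hz)[w [hw ew]]; apply: md; exists w; split=> //.
    by rewrite ez -mulrA -ew mulr1.
  by case: (normk z) => [|[]].
have lt : (normk d < n)%N.
  rewrite -ltnS; apply: leq_trans hn; rewrite ez normkM // ltnS.
  have : normk d != 0%N by rewrite normk_eq0.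
  nia.
have [q [hq qd]] := IH d lt hd d0 d1.
by exists q; split=> //; apply: dvd_Ok_trans dm.
Qed.

Lemma Ok_units u : in_Ok u -> dvd_Ok u 1 -> exists (s i : nat), (i < 3)%N /\ u = (-1) ^+ s * zeta3 ^+ i.
Proof.
move=> hu [v [hv uv]]; have h1 : normk u = 1%N.
  by have := normkM u v hu hv; rewrite -uv normk1 => /esym/eqP; rewrite muln_eq1 => /andP[/eqP].
have [a [b ab]] := in_OkP u hu.
have e : a ^+ 2 - a * b + b ^+ 2 = 1 :> int.
  apply/eqP; rewrite -(eqr_int algC) -[1%:~R]/(1%:R) -[in X in _ == X]h1 -normkE // ab.
  have := conj_k a%:~R b%:~R; rewrite !ratr_int => ->.
  rewrite !(rmorphD, rmorphN, rmorphM, rmorphXn) /=.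
  apply/eqP; have h := zeta3_sqr; ring: h.
(* Since [4 (a ^ 2 - a b + b ^ 2) = (2 a - b) ^ 2 + 3 b ^ 2], only finitely many pairs remain, and
   six of them are solutions. *)
have hb : - 1 <= b <= 1 by nia.
have ha : - 1 <= a <= 1 by nia.
have hz := zeta3_sqr.
have [ea|[ea|ea]] : a = -1 \/ a = 0 \/ a = 1 by lia.
all: have [eb|[eb|eb]] : b = -1 \/ b = 0 \/ b = 1 by lia.
all: move: e ab; rewrite ea eb => e ab; try lia; rewrite ab.
- by exists 0%N, 2%N; split=> //; ring: hz.
- by exists 1%N, 0%N; split=> //; ring.
- by exists 1%N, 1%N; split=> //; ring.
- by exists 0%N, 1%N; split=> //; ring.
- by exists 0%N, 0%N; split=> //; ring.
- by exists 1%N, 2%N; split=> //; ring: hz.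
Qed.

(** Its norm is the prime number 3, so any prime factor of it is an associate. *)
Lemma prime_sqrtm3 : prime_Ok sqrtm3.
Proof.
have hl := in_Ok_sqrtm3; have l0 := sqrtm3_neq0; have l2 := sqrtm3_sqr.
have n3 : normk sqrtm3 = 3%N.
  have hc : sqrtm3^* = - sqrtm3.
    have := conj_k 1 2; rewrite rmorph1 ratr_nat -sqrtm3E => ->; rewrite sqrtm3E; ring.
  by apply/eqP; rewrite -(eqr_nat algC) -normkE // hc mulrN -expr2 l2 opprK.
have ln1 : ~ dvd_Ok sqrtm3 1.
  by move/(dvd_Ok_normk hl in_Ok1 (oner_neq0 _)); rewrite n3 normk1.
have [q [hq [e [he le]]]] := prime_Ok_factor _ hl l0 ln1.
have [hqO q0 qn1 qp] := hq.
have : (normk q * normk e = 3)%N by rewrite -normkM // -le n3.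
have hq1 : normk q != 1%N by apply/eqP => /(normk1_unit hqO).
move=> h; have /(normk1_unit he)[e' [he' ee]] : normk e = 1%N by move: h hq1 => /=; nia.
have qle : q = sqrtm3 * e' by rewrite le -mulrA -ee mulr1.
split=> // x y hx hy [z [hz exy]].
have : dvd_Ok q (x * y) by exists (e * z); split; okc; rewrite exy le mulrA.
have lq : dvd_Ok sqrtm3 q by exists e'.
by case/(qp _ _ hx hy) => h'; [left|right]; apply: dvd_Ok_trans lq h'.
Qed.

Lemma Aint_integralOver x : x \in Aint <-> integralOver (intr : int -> algC) x.
Proof.
split=> [/floorpP[p hp]|[p pm rp]].
  exists p; last by rewrite -hp; exact: root_minCpoly.
  have := minCpoly_monic x; rewrite hp !monicE lead_coef_map_inj; last by [].
    by rewrite -[1 in X in X -> _]/(1%:~R) eqr_int.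
  exact: intr_inj.
apply: (root_monic_Aint rp); first exact: monic_map.
by apply/polyOverP => i; rewrite coef_map /=; exact: intr_int.
Qed.

Lemma Aint_integral (p : {poly algC}) x :
  p \is monic -> root p x -> (forall i, p`_i \in Aint) -> x \in Aint.
Proof.
move=> pm rp hp; apply/Aint_integralOver; apply: (integral_root_monic pm rp) => y /(nthP 0)[i _ <-].
exact/Aint_integralOver.
Qed.

(** * The cubic extension *)

Section CubicExtension.

Variables (r1 pi1 : algC) (tau : algC -> algC).
Hypotheses (pi1_prime : prime_Ok pi1) (pi1_primary : primary pi1).
Hypotheses (r1E : r1 ^+ 3 = pi1) (tauP : is_tau r1 tau).

Notation K1 := (in_K1 r1).
Notation OK1 := (in_OK1 r1).

Lemma in_Ok_pi1 : in_Ok pi1. Proof. by case: pi1_prime. Qed.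
Lemma pi1_neq0 : pi1 != 0. Proof. by case: pi1_prime. Qed.
Lemma r1_neq0 : r1 != 0.
Proof. by apply: contraNneq pi1_neq0 => h; rewrite -r1E h expr0n. Qed.

Lemma K1_k {x} : in_k x -> K1 x.
Proof.
by move=> hx; exists x, 0, 0; split=> //; try exact: in_k0; rewrite !mul0r !addr0.
Qed.
Lemma K1_r1 : K1 r1.
Proof.
by exists 0, 1, 0; split; try exact: in_k0; try exact: in_k1; rewrite mul1r mul0r add0r addr0.
Qed.
Lemma K1D {x y} : K1 x -> K1 y -> K1 (x + y).
Proof.
case=> a [b [c [ha hb hc ->]]] [d [e [f [hd he hf ->]]]].
exists (a + d), (b + e), (c + f); split; try exact: in_kD; ring.
Qed.
Lemma K1N {x} : K1 x -> K1 (- x).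
Proof.
case=> a [b [c [ha hb hc ->]]]; exists (- a), (- b), (- c); split; try exact: in_kN; ring.
Qed.
Lemma K1M {x y} : K1 x -> K1 y -> K1 (x * y).
Proof.
have hp := in_Ok_pi1.1.
case=> a [b [c [ha hb hc ->]]] [d [e [f [hd he hf ->]]]].
exists (a * d + pi1 * (b * f + c * e)), (a * e + b * d + pi1 * (c * f)), (a * f + b * e + c * d).
split; try by repeat first [assumption | apply: in_kD | apply: in_kM].
ring: r1E.
Qed.
Lemma K1X {x} n : K1 x -> K1 (x ^+ n).
Proof. by move=> hx; elim: n => [|n IH]; [exact: K1_k in_k1 | rewrite exprS; exact: K1M]. Qed.

(** * Galois action on [K1], traces and norms *)

Lemma tauD {x y} : K1 x -> K1 y -> tau (x + y) = tau x + tau y.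
Proof. by case: tauP => h _ _ _; exact: h. Qed.
Lemma tauM {x y} : K1 x -> K1 y -> tau (x * y) = tau x * tau y.
Proof. by case: tauP => _ h _ _; exact: h. Qed.
Lemma tau_k {x} : in_k x -> tau x = x.
Proof. by case: tauP => _ _ h _; exact: h. Qed.
Lemma tau_r1 : tau r1 = zeta3 * r1.
Proof. by case: tauP. Qed.
Lemma tauX {x} n : K1 x -> tau (x ^+ n) = tau x ^+ n.
Proof.
move=> hx; elim: n => [|n IH]; first by rewrite !expr0 tau_k //; exact: in_k1.
by rewrite !exprS tauM ?IH //; exact: K1X.
Qed.

Lemma tauE a b c : in_k a -> in_k b -> in_k c ->
  tau (a + b * r1 + c * r1 ^+ 2) = a + (b * zeta3) * r1 + (c * zeta3 ^+ 2) * r1 ^+ 2.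
Proof.
move=> ha hb hc; have hr := K1_r1.
have h2 := K1X 2 hr.
have e1 : tau (b * r1) = b * (zeta3 * r1) by rewrite (tauM (K1_k hb) hr) tau_r1 tau_k.
have e2 : tau (c * r1 ^+ 2) = c * (zeta3 * r1) ^+ 2 by rewrite (tauM (K1_k hc) h2) tauX // tau_r1 tau_k.
rewrite !tauD ?e1 ?e2 ?(tau_k ha); first ring.
all: by repeat first [assumption | apply: K1D | apply: K1M | apply: K1_k].
Qed.

Lemma K1_tau {x} : K1 x -> K1 (tau x).
Proof.
case=> a [b [c [ha hb hc ->]]]; rewrite tauE //.
by exists a, (b * zeta3), (c * zeta3 ^+ 2); split=> //; apply: in_kM => //; [|apply: in_kX]; exact: in_k_zeta3.
Qed.

Lemma tau_tauE a b c : in_k a -> in_k b -> in_k c ->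
  tau (tau (a + b * r1 + c * r1 ^+ 2)) = a + (b * zeta3 ^+ 2) * r1 + (c * zeta3) * r1 ^+ 2.
Proof.
move=> ha hb hc; have hz := in_k_zeta3; have z3 := zeta3_cube.
rewrite tauE // tauE //; try by repeat first [assumption | apply: in_kM | apply: in_kX].
ring: z3.
Qed.

Lemma tau3 {x} : K1 x -> tau (tau (tau x)) = x.
Proof.
case=> a [b [c [ha hb hc ->]]]; have hz := in_k_zeta3; have z3 := zeta3_cube.
rewrite tau_tauE // tauE //; try by repeat first [assumption | apply: in_kM | apply: in_kX].
ring: z3.
Qed.

Lemma tau0 : tau 0 = 0. Proof. exact: tau_k in_k0. Qed.

Lemma tau_eq0 {x} : K1 x -> (tau x == 0) = (x == 0).
Proof.
move=> hx; apply/eqP/eqP => [h|->]; last exact: tau0.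
by rewrite -(tau3 hx) h !tau0.
Qed.

Lemma trace_k {x} : K1 x -> in_k (x + tau x + tau (tau x)).
Proof.
case=> a [b [c [ha hb hc ->]]]; rewrite tau_tauE // tauE //.
have -> : a + b * r1 + c * r1 ^+ 2 + (a + b * zeta3 * r1 + c * zeta3 ^+ 2 * r1 ^+ 2) +
   (a + b * zeta3 ^+ 2 * r1 + c * zeta3 * r1 ^+ 2) = 3 * a by have hz := zeta3_sqr; ring: hz.
by apply: in_kM => //; exact: in_k_nat.
Qed.

(** A fixed [x] has trace [3 x], and the trace is in [k] whatever coordinates represent [x]. *)
Lemma tau_fixed_k {x} : K1 x -> tau x = x -> in_k x.
Proof.
move=> hx h; have := trace_k hx; rewrite !h.
have -> : x + x + x = 3 * x by ring.
move=> h3; have -> : x = 3^-1 * (3 * x) by rewrite mulKf // pnatr_eq0.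
by apply: in_kM => //; apply: in_kV; exact: in_k_nat.
Qed.

Lemma norm_k {x} : K1 x -> in_k (x * tau x * tau (tau x)).
Proof.
move=> hx; have h1 := K1_tau hx; have h2 := K1_tau h1; have h12 := K1M hx h1.
apply: tau_fixed_k; first exact: K1M.
by rewrite !tauM // tau3 //; ring.
Qed.

Lemma K1V {x} : K1 x -> K1 x^-1.
Proof.
move=> hx; have [->|x0] := eqVneq x 0; first by rewrite invr0; exact: K1_k in_k0.
have h1 := K1_tau hx; have h2 := K1_tau h1.
have -> : x^-1 = tau x * tau (tau x) * (x * tau x * tau (tau x))^-1.
  by field; rewrite !tau_eq0 // x0.
by apply: K1M; [exact: K1M | apply: K1_k; apply: in_kV; exact: norm_k].
Qed.

Lemma tauV {x} : K1 x -> tau x^-1 = (tau x)^-1.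
Proof.
move=> hx; have [->|x0] := eqVneq x 0; first by rewrite invr0 tau0 invr0.
have t0 : tau x != 0 by rewrite tau_eq0.
by apply: (mulfI t0); rewrite -(tauM hx (K1V hx)) !divff // tau_k //; exact: in_k1.
Qed.

(** [tau] is a morphism on [K1] only, not on [algC], so it is pushed through the Horner evaluation
    of the integral minimal polynomial by induction on the list of coefficients. *)
Lemma Aint_tau {x} : K1 x -> x \in Aint -> tau x \in Aint.
Proof.
move=> hx /[dup] xA /floorpP[p hp].
have H (s : seq int) : K1 (horner_rec [seq i%:~R | i <- s] x) /\
   tau (horner_rec [seq i%:~R | i <- s] x) = horner_rec [seq i%:~R | i <- s] (tau x).
  elim: s => [|a s [IH1 IH2]] /=; first by split; [exact: K1_k in_k0 | exact: tau0].
  have ha := in_k_int a; have hm := K1M IH1 hx.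
  split; first by apply: K1D => //; exact: K1_k.
  by rewrite (tauD hm (K1_k ha)) (tauM IH1 hx) IH2 (tau_k ha).
have e : (minCpoly x : seq algC) = [seq i%:~R | i <- p].
  (* The default 1 of [last] is the one in the invariant of polynomials, so the side condition is
     what [p] carries. *)
  rewrite hp map_polyE (@PolyK _ 1%:~R) // last_map intr_eq0.
  by case: (p).
apply: (@root_monic_Aint (minCpoly x)) => //; last exact: minCpoly_monic.
have := root_minCpoly x; rewrite /root /horner e => /eqP h0.
by rewrite -(H p).2 h0 tau0.
Qed.

Lemma OK1_Ok {x} : in_Ok x -> OK1 x.
Proof. by case=> h ?; split=> //; exact: K1_k. Qed.
Lemma OK1_r1 : OK1 r1.
Proof. by split; [exact: K1_r1 | apply: Aint_cube; rewrite r1E; exact: in_Ok_pi1.2]. Qed.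
Lemma OK1D {x y} : OK1 x -> OK1 y -> OK1 (x + y).
Proof. by case=> ? ? [? ?]; split; [exact: K1D | exact: rpredD]. Qed.
Lemma OK1N {x} : OK1 x -> OK1 (- x).
Proof. by case=> ? ?; split; [exact: K1N | rewrite rpredN]. Qed.
Lemma OK1M {x y} : OK1 x -> OK1 y -> OK1 (x * y).
Proof. by case=> ? ? [? ?]; split; [exact: K1M | exact: rpredM]. Qed.
Lemma OK1X {x} n : OK1 x -> OK1 (x ^+ n).
Proof. by case=> ? ?; split; [exact: K1X | exact: rpredX]. Qed.
Lemma OK1_tau {x} : OK1 x -> OK1 (tau x).
Proof. by case=> ? ?; split; [exact: K1_tau | exact: Aint_tau]. Qed.

Ltac okc1 := repeat first [ assumption | apply: OK1_r1 | apply: OK1_Ok; solve [okc]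
  | apply: OK1N | apply: OK1D | apply: OK1M | apply: OK1X | apply: OK1_tau ].

Lemma trace_Ok {x} : OK1 x -> in_Ok (x + tau x + tau (tau x)).
Proof.
move=> hx; split; first exact: trace_k hx.1.
suff : OK1 (x + tau x + tau (tau x)) by case.
by okc1.
Qed.

Lemma norm_Ok {x} : OK1 x -> in_Ok (x * tau x * tau (tau x)).
Proof.
move=> hx; split; first exact: norm_k hx.1.
suff : OK1 (x * tau x * tau (tau x)) by case.
by okc1.
Qed.

Lemma sym2_Ok {x} : OK1 x -> in_Ok (x * tau x + x * tau (tau x) + tau x * tau (tau x)).
Proof.
move=> hx; have h1 := OK1_tau hx; have h2 := OK1_tau h1.
have hs : OK1 (x * tau x + x * tau (tau x) + tau x * tau (tau x)) by okc1.
split; last exact: hs.2.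
apply: tau_fixed_k; first exact: hs.1.
have k0 := hx.1; have k1 := h1.1; have k2 := h2.1.
rewrite !tauD; try by repeat first [assumption | apply: K1D | apply: K1M].
by rewrite !tauM // !tau3 //; ring.
Qed.

(** An integer whose minimal polynomial has a derivative prime to 3 at [omega], whereas for [r1] the
    derivative is [3 r1 ^ 2]. This gives access to the prime [sqrt(-3)]. *)
Definition omega := (r1 - 1) / sqrtm3.

Lemma r1_omega : r1 = 1 + sqrtm3 * omega.
Proof. by rewrite /omega; field; exact: sqrtm3_neq0. Qed.

Lemma OK1_omega : OK1 omega.
Proof.
have l0 := sqrtm3_neq0; have l2 := sqrtm3_sqr.
split.
  apply: K1M; first by apply: K1D; [exact: K1_r1 | apply: K1N; exact: K1_k in_k1].
  by apply: K1_k; apply: in_kV; exact: in_Ok_sqrtm3.1.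
have [z [hz ez]] := pi1_primary.
(* This is [((1 + sqrt(-3) X) ^ 3 - pi1) / sqrt(-3) ^ 3], computed with [3 = - sqrt(-3) ^ 2] and
   [pi1 - 1 = 3 sqrt(-3) z]. *)
apply: (@Aint_integral (Poly [:: z; -1; - sqrtm3; 1])).
- by rewrite monicE lead_coefE (@PolyK _ 0) /= ?oner_neq0.
- rewrite /root horner_Poly /= ; apply/eqP.
  apply: (mulfI (expf_neq0 3 l0)); rewrite mulr0.
  have : (1 + sqrtm3 * omega) ^+ 3 - 1 = 3 * sqrtm3 * z by rewrite -r1_omega r1E.
  have -> : (1 + sqrtm3 * omega) ^+ 3 - 1 = sqrtm3 ^+ 3 * omega ^+ 3 + 3 * sqrtm3 ^+ 2 * omega ^+ 2
      + 3 * sqrtm3 * omega by ring.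
  have e3 : 3 = - sqrtm3 ^+ 2 by rewrite l2 opprK.
  rewrite e3 => h; rewrite -[RHS](subrr (- sqrtm3 ^+ 2 * sqrtm3 * z)) -{1}h; ring.
- case=> [|[|[|[|i]]]]; rewrite coef_Poly /= ?rpredN ?rpred1 //; first exact: hz.2.
    exact: in_Ok_sqrtm3.2.
  by rewrite nth_nil rpred0.
Qed.

(** * Prime ideals of the ring of integers of [K1] *)

Section PrimeIdeal.

Variable Q : algC -> Prop.
Hypothesis Q_prime : prime_ideal r1 Q.

Lemma prime_ideal_OK1 {x} : Q x -> OK1 x. Proof. by case: Q_prime => -[h _ _ _] _ _; exact: h. Qed.
Lemma prime_ideal0 : Q 0. Proof. by case: Q_prime => -[]. Qed.
Lemma prime_idealD {x y} : Q x -> Q y -> Q (x + y).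
Proof. by case: Q_prime => -[_ _ h _] _ _; exact: h. Qed.
Lemma prime_idealMl {x y} : OK1 x -> Q y -> Q (x * y).
Proof. by case: Q_prime => -[_ _ _ h] _ _; exact: h. Qed.
Lemma prime_idealMr {x y} : OK1 x -> Q y -> Q (y * x).
Proof. by move=> hx hy; rewrite mulrC; exact: prime_idealMl. Qed.
Lemma prime_idealN {x} : Q x -> Q (- x).
Proof. by move=> h; rewrite -mulN1r; apply: prime_idealMl => //; okc1. Qed.
Lemma prime_idealB {x y} : Q x -> Q y -> Q (x - y).
Proof. by move=> hx hy; apply: prime_idealD => //; exact: prime_idealN. Qed.
Lemma prime_ideal_n1 : ~ Q 1. Proof. by case: Q_prime. Qed.
Lemma prime_idealM_or {x y} : OK1 x -> OK1 y -> Q (x * y) -> Q x \/ Q y.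
Proof. by case: Q_prime => _ _ h; exact: h. Qed.
Lemma prime_ideal_nM {x y} : OK1 x -> OK1 y -> ~ Q x -> ~ Q y -> ~ Q (x * y).
Proof. by move=> hx hy nx ny /(prime_idealM_or hx hy)[]. Qed.
Lemma prime_ideal_nX {x} n : OK1 x -> ~ Q x -> ~ Q (x ^+ n).
Proof.
move=> hx nx; elim: n => [|n IH]; first exact: prime_ideal_n1.
by rewrite exprS; apply: prime_ideal_nM => //; okc1.
Qed.

(** [q] generates a maximal ideal of [O_k]: otherwise a Bezout relation between [q] and [c] would
    put 1 in [Q]. *)
Lemma prime_ideal_Ok_dvd {q c} : prime_Ok q -> Q q -> in_Ok c -> Q c -> dvd_Ok q c.
Proof.
move=> hq Qq hc Qc; apply: boolp.contrapT => /(prime_bezout hq hc)[u [v [hu hv e]]].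
by apply: prime_ideal_n1; rewrite e; apply: prime_idealD; apply: prime_idealMl => //; okc1.
Qed.

(** The conjugate prime [tau^-1 Q]; the valuation of [tau alpha] at [Q] is that of [alpha] there. *)
Lemma prime_ideal_tau : prime_ideal r1 (fun x => OK1 x /\ Q (tau x)).
Proof.
split; first split.
- by move=> x [].
- by split; [okc1 | rewrite tau0; exact: prime_ideal0].
- move=> x y [hx qx] [hy qy]; split; first by okc1.
  by rewrite (tauD hx.1 hy.1); exact: prime_idealD.
- move=> x y hx [hy qy]; split; first by okc1.
  by rewrite (tauM hx.1 hy.1); apply: prime_idealMl => //; okc1.
- by case=> _; rewrite (tau_k in_k1); exact: prime_ideal_n1.
- move=> x y hx hy [_]; rewrite (tauM hx.1 hy.1) => /prime_idealM_or[]; try by okc1.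
    by left.
  by right.
Qed.

End PrimeIdeal.

Lemma principalD {a x y} : principal r1 a x -> principal r1 a y -> principal r1 a (x + y).
Proof. by case=> u [hu ->] [v [hv ->]]; exists (u + v); split; [okc1 | ring]. Qed.
Lemma principalMl {a x y} : OK1 x -> principal r1 a y -> principal r1 a (x * y).
Proof. by move=> hx [v [hv ->]]; exists (x * v); split; [okc1 | ring]. Qed.

(* The minimal polynomial of [omega] over [O_k] has derivative [- r1 ^+ 2] at [omega]; this is Euler's
   formula for the dual basis of [1, omega, omega ^+ 2] under the trace form. *)
Lemma trace_dual {x} : K1 x ->
  r1 ^+ 2 * x = (x + tau x + tau (tau x)) * (1 + sqrtm3 * omega - omega ^+ 2)
    - (x * omega + tau (x * omega) + tau (tau (x * omega))) * (omega - sqrtm3)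
    - (x * omega ^+ 2 + tau (x * omega ^+ 2) + tau (tau (x * omega ^+ 2))).
Proof.
move=> hx; have ho := OK1_omega.1; have ho1 := K1_tau ho; have ho2 := K1_tau ho1.
have hx1 := K1_tau hx; have hl := K1_k in_Ok_sqrtm3.1; have hr := K1_r1.
have hz := zeta3_sqr; have l2 := sqrtm3_sqr; have k1 := K1_k in_k1.
have e0 : sqrtm3 * omega = r1 - 1 by rewrite r1_omega; ring.
have e1 : sqrtm3 * tau omega = zeta3 * r1 - 1.
  rewrite -[in LHS](tau_k in_Ok_sqrtm3.1) -(tauM hl ho) e0 (tauD hr (K1N k1)) tau_r1.
  by rewrite (tau_k (in_kN in_k1)).
have e2 : sqrtm3 * tau (tau omega) = zeta3 ^+ 2 * r1 - 1.
  rewrite -[in LHS](tau_k in_Ok_sqrtm3.1) -(tauM hl ho1) e1.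
  rewrite (tauD (K1M (K1_k in_k_zeta3) hr) (K1N k1)) (tauM (K1_k in_k_zeta3) hr) tau_r1.
  rewrite (tau_k in_k_zeta3) (tau_k (in_kN in_k1)); ring.
have hox := K1X 2 ho; have ho1x := K1X 2 ho1.
rewrite !(tauM hx) // !(tauM hx1) // !tauX //.
(* After this scaling [omega] and its conjugates occur only multiplied by [sqrtm3], where [e0],
   [e1], [e2] turn them into polynomials in [r1] and [zeta3]. *)
apply: (mulfI (expf_neq0 2 sqrtm3_neq0)).
move: (tau x) (tau (tau x)) => y z.
rewrite [RHS](_ : _ = (x + y + z) * (sqrtm3 ^+ 2 * (1 + sqrtm3 * omega) - (sqrtm3 * omega) ^+ 2)
  - (x * (sqrtm3 * omega) + y * (sqrtm3 * tau omega) + z * (sqrtm3 * tau (tau omega)))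
    * (sqrtm3 * omega - sqrtm3 ^+ 2)
  - (x * (sqrtm3 * omega) ^+ 2 + y * (sqrtm3 * tau omega) ^+ 2 + z * (sqrtm3 * tau (tau omega)) ^+ 2)).
  by rewrite e0 e1 e2 l2; ring: hz.
ring.
Qed.

(** * Valuations at a prime of the cubic extension *)

Section PrimeAbove.

Variables (q : algC) (Q : algC -> Prop).
Hypotheses (q_prime : prime_Ok q) (q_pi1 : ~ dvd_Ok q pi1).
Hypotheses (Q_prime : prime_ideal r1 Q) (Qq : Q q).

Lemma in_Ok_q : in_Ok q. Proof. by case: q_prime. Qed.
Lemma q_neq0 : q != 0. Proof. by case: q_prime. Qed.
Let q_Ok := in_Ok_q.

Lemma principal_sub_prime {x} : principal r1 q x -> Q x.
Proof. by case=> y [hy ->]; exact: (prime_idealMr Q Q_prime hy Qq). Qed.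

(** As [q] is fixed by [tau], all conjugates of [z] are nilpotent modulo [q] and so lie in [Q]; the
    trace is then in [Q] and in [O_k]. *)
Lemma trace_dvd z n : OK1 z -> principal r1 q (z ^+ n) -> dvd_Ok q (z + tau z + tau (tau z)).
Proof.
have H y : OK1 y -> principal r1 q (y ^+ n) -> Q y /\ principal r1 q (tau y ^+ n).
  move=> hy hyn; split.
    by apply: boolp.contrapT => /(prime_ideal_nX Q Q_prime n hy); apply; exact: principal_sub_prime.
  case: hyn => w [hw e]; exists (tau w); split; first by okc1.
  by rewrite -(tauX n hy.1) e (tauM (K1_k q_Ok.1) hw.1) tau_k //; case: q_Ok.
move=> hz h; have [q0 h1] := H _ hz h.
have [q1 h2] := H _ (OK1_tau hz) h1; have [q2 _] := H _ (OK1_tau (OK1_tau hz)) h2.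
apply: (prime_ideal_Ok_dvd Q Q_prime q_prime Qq); first exact: trace_Ok.
by apply: prime_idealD => //; exact: prime_idealD.
Qed.

(* [K1] is unramified at every prime not dividing [pi1]. *)
Lemma principal_reduced {x} n : OK1 x -> principal r1 q (x ^+ n) -> principal r1 q x.
Proof.
move=> hx hxn; have ho := OK1_omega.
have P_mul y : OK1 y -> principal r1 q ((x * y) ^+ n).
  by move=> hy; rewrite exprMn mulrC; apply: principalMl => //; okc1.
have [s0 [hs0 e0]] := trace_dvd _ _ hx hxn.
have [s1 [hs1 e1]] := trace_dvd _ n (OK1M hx ho) (P_mul _ ho).
have [s2 [hs2 e2]] := trace_dvd _ n (OK1M hx (OK1X 2 ho)) (P_mul _ (OK1X 2 ho)).
(* [x], [x omega] and [x omega ^ 2] are all nilpotent modulo [q], so [q] divides the three traces of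
   [trace_dual], hence [r1 ^ 2 x]. Finally [pi1] is invertible modulo [q]. *)
have h : principal r1 q (pi1 * x).
  exists (r1 * (s0 * (1 + sqrtm3 * omega - omega ^+ 2) - s1 * (omega - sqrtm3) - s2)).
  split; first by okc1.
  rewrite -r1E exprS -mulrA trace_dual ?e0 ?e1 ?e2; [ring | exact: hx.1].
have [u [v [hu hv e]]] := prime_bezout q_prime in_Ok_pi1 q_pi1.
rewrite -[x]mul1r e mulrDl; apply: principalD.
  by exists (u * x); split; [okc1 | ring].
by rewrite -mulrA; apply: principalMl => //; okc1.
Qed.

(** [q] generates [Q] locally. Read this off [x ^ 3 - S1 x ^ 2 + S2 x - N = 0] with [q | N]: take
    [s = x ^ 2 - S1 x + S2] if [q] does not divide [S2], else [s = x - S1] if [q] does not divide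
    [S1], else [s = 1]. In the last two cases a power of [s x] is divisible by [q], and
    [principal_reduced] applies. *)
Lemma prime_ideal_locally_principal {x} : Q x -> exists s, [/\ OK1 s, ~ Q s & principal r1 q (s * x)].
Proof.
move=> Qx; have hx := prime_ideal_OK1 Q Q_prime Qx.
have h1 := OK1_tau hx; have h2 := OK1_tau h1.
have [n0 en0] : dvd_Ok q (x * tau x * tau (tau x)).
  apply: (prime_ideal_Ok_dvd Q Q_prime q_prime Qq); first exact: norm_Ok.
  by rewrite -mulrA; apply: prime_idealMr => //; okc1.
have hs1 := trace_Ok hx; have hs2 := sym2_Ok hx.
set S1 := x + _ + _ in hs1; set S2 := x * _ + _ + _ in hs2.
have e : x * (x ^+ 2 - S1 * x + S2) = x * tau x * tau (tau x) by rewrite /S1 /S2; ring.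
have [[d2 [hd2 ed2]]|nd2] := boolp.EM (dvd_Ok q S2); last first.
  exists (x ^+ 2 - S1 * x + S2); split; first by okc1.
    move=> h; apply: nd2; apply: (prime_ideal_Ok_dvd Q Q_prime q_prime Qq) => //.
    have -> : S2 = (x ^+ 2 - S1 * x + S2) - (x - S1) * x by ring.
    by apply: prime_idealB => //; apply: prime_idealMl => //; okc1.
  by exists n0; split; [okc1; exact: OK1_Ok en0.1 | rewrite mulrC e en0.2].
have [[d1 [hd1 ed1]]|nd1] := boolp.EM (dvd_Ok q S1); last first.
  exists (x - S1); split; first by okc1.
    move=> h; apply: nd1; apply: (prime_ideal_Ok_dvd Q Q_prime q_prime Qq) => //.
    have -> : S1 = x - (x - S1) by ring.
    exact: prime_idealB.
  apply: (principal_reduced 2); first by okc1.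
  exists ((x - S1) * (n0 - d2 * x)); split; first by okc1; exact: OK1_Ok en0.1.
  have -> : ((x - S1) * x) ^+ 2 = (x - S1) * (x * (x ^+ 2 - S1 * x + S2) - S2 * x) by ring.
  by rewrite e en0.2 ed2; ring.
exists 1; split; [by okc1 | exact: prime_ideal_n1 | rewrite mul1r; apply: (principal_reduced 3) => //].
exists (n0 - d2 * x + d1 * x ^+ 2); split; first by okc1; exact: OK1_Ok en0.1.
have -> : x ^+ 3 = x * (x ^+ 2 - S1 * x + S2) - S2 * x + S1 * x ^+ 2 by ring.
by rewrite e en0.2 ed2 ed1; ring.
Qed.

(* [q] is a uniformizer at [Q], so [x] has valuation [n] iff [x / q ^+ n] is a unit of the localization. *)
Definition val_at (x : algC) (n : nat) : Prop :=
  exists s w, [/\ OK1 s, OK1 w, ~ Q s, ~ Q w & x * s = q ^+ n * w].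

Definition val_ge (n : nat) (x : algC) : Prop :=
  OK1 x /\ exists s w, [/\ OK1 s, OK1 w, ~ Q s & x * s = q ^+ n * w].

Lemma val_at_neq0 {x n} : val_at x n -> x != 0.
Proof.
case=> s [w [hs hw ns nw e]]; apply/eqP => x0; move: e; rewrite x0 mul0r => /esym/eqP.
rewrite mulf_eq0 expf_eq0 (negPf q_neq0) andbF /= => /eqP w0.
by apply: nw; rewrite w0; exact: prime_ideal0.
Qed.

Lemma val_atW {x n} : OK1 x -> val_at x n -> val_ge n x.
Proof. by move=> hx [s [w [hs hw ns nw e]]]; split=> //; exists s, w. Qed.

Lemma val_ge_le {x n m} : val_at x n -> val_ge m x -> (m <= n)%N.
Proof.
case=> s [w [hs hw ns nw e]] [_ [s' [w' [hs' hw' ns' e']]]].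
rewrite leqNgt; apply/negP => lt.
have h : w * s' = q * (q ^+ (m - n).-1 * (w' * s)).
  apply: (mulfI (expf_neq0 n q_neq0)).
  have -> : q ^+ n * (w * s') = (q ^+ n * w) * s' by ring.
  rewrite -e; have -> : x * s * s' = x * s' * s by ring.
  rewrite e' -[m in q ^+ m](@subnK n m) 1?ltnW // -[(m - n)%N]prednK ?subn_gt0 // exprD exprS.
  by rewrite prednK ?subn_gt0 //; ring.
have hqn := in_OkX (m - n).-1 q_Ok.
by apply: (prime_ideal_nM Q Q_prime hw hs' nw ns'); rewrite h; apply: prime_idealMr => //; okc1.
Qed.

Lemma val_at_uniq {x n m} : OK1 x -> val_at x n -> val_at x m -> n = m.
Proof.
move=> hx vn vm; apply/eqP; rewrite eqn_leq.
by rewrite (val_ge_le vn (val_atW hx vm)) (val_ge_le vm (val_atW hx vn)).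
Qed.

Lemma val_atM {x y n m} : val_at x n -> val_at y m -> val_at (x * y) (n + m).
Proof.
case=> s [w [hs hw ns nw e]] [s' [w' [hs' hw' ns' nw' e']]].
exists (s * s'), (w * w'); split; try okc1; try exact: prime_ideal_nM.
by rewrite exprD mulrACA e e'; ring.
Qed.

Lemma val_at_nQ {x} : OK1 x -> ~ Q x -> val_at x 0.
Proof.
move=> hx nx; exists 1, x; split=> //; [by okc1 | exact: prime_ideal_n1 | by rewrite mulr1 mul1r].
Qed.

Lemma val_atX {x n} k : val_at x n -> val_at (x ^+ k) (k * n).
Proof.
move=> h; elim: k => [|k IH]; first by apply: val_at_nQ; [okc1 | exact: prime_ideal_n1].
by rewrite exprS mulSn; exact: val_atM.
Qed.

(** On [O_k] the valuation at [Q] is the one at [q]: factors [q] are split off one by one, since [Q]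
    meets [O_k] in the multiples of [q]. *)
Lemma val_ge_Ok_dvd {c} n : in_Ok c -> val_ge n c -> dvd_Ok (q ^+ n) c.
Proof.
move=> hc [_ [s [w [hs hw ns e]]]].
have : forall m, (m <= n)%N -> dvd_Ok (q ^+ m) c; last by apply.
elim=> [|m IH] lt; first by exists c; split; rewrite ?expr0 ?mul1r.
have [d [hd ed]] := IH (ltnW lt).
have h : d * s = q * (q ^+ (n - m).-1 * w).
  apply: (mulfI (expf_neq0 m q_neq0)); rewrite [LHS]mulrA -ed e.
  rewrite -[n in q ^+ n](@subnK m n) 1?ltnW // -[(n - m)%N]prednK ?subn_gt0 // exprD exprS.
  by rewrite prednK ?subn_gt0 //; ring.
have hqn := in_OkX (n - m).-1 q_Ok.
have : Q (d * s) by rewrite h; apply: prime_idealMr => //; okc1.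
case/(prime_idealM_or Q Q_prime (OK1_Ok hd) hs) => // /(prime_ideal_Ok_dvd Q Q_prime q_prime Qq hd)[d' [hd' ed']].
by exists d'; split=> //; rewrite ed ed' exprS; ring.
Qed.

(** Without an exact valuation [x], and so its norm to [k], would be divisible by every [q ^+ n],
    which the growth of [normk (q ^+ n)] forbids. *)
Lemma val_at_exists {x} : OK1 x -> x != 0 -> exists n, val_at x n.
Proof.
move=> hx x0; apply: boolp.contrapT => nval.
have h1 := OK1_tau hx; have h2 := OK1_tau h1.
pose N := x * tau x * tau (tau x).
have hN : in_Ok N := norm_Ok hx.
have N0 : N != 0 by rewrite /N !mulf_neq0 ?(tau_eq0 h1.1) ?(tau_eq0 hx.1).
have H n : val_ge n x.
  elim: n => [|n [_ [s [w [hs hw ns e]]]]].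
    by split=> //; exists 1, x; split=> //; [okc1 | exact: prime_ideal_n1 | rewrite mulr1 mul1r].
  split=> //; have Qw : Q w by apply: boolp.contrapT => nw; apply: nval; exists n, s, w.
  have [s' [hs' ns' [w' [hw' e']]]] := prime_ideal_locally_principal Qw.
  exists (s * s'), w'; split=> //; [by okc1 | exact: prime_ideal_nM | ].
  by rewrite mulrA e -mulrA [w * s']mulrC e' exprSr mulrA.
have HN n : dvd_Ok (q ^+ n) N.
  apply: val_ge_Ok_dvd => //; split; first exact: OK1_Ok.
  have [_ [s [w [hs hw ns e]]]] := H n.
  exists s, (w * tau x * tau (tau x)); split; try okc1.
  have -> : N * s = (x * s) * tau x * tau (tau x) by rewrite /N; ring.
  by rewrite e; ring.
have hq1 : (1 < normk q)%N.
  have : normk q != 0%N by rewrite normk_eq0 // q_neq0.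
  have : normk q <> 1%N by case: q_prime => _ _ qn1 _ /(normk1_unit q_Ok).
  by case: (normk q) => [|[]].
have hnk n : normk (q ^+ n) = (normk q ^ n)%N.
  by elim: n => [|n IH]; [rewrite expr0 normk1 | rewrite exprS normkM ?IH ?expnS //; exact: in_OkX].
have := dvd_Ok_normk (in_OkX _ q_Ok) hN N0 (HN (normk N)).
by rewrite hnk leqNgt ltn_expl.
Qed.

Lemma val_ge_ideal n : ideal r1 (val_ge n).
Proof.
split.
- by move=> x [].
- by split; [okc1 | exists 1, 0; split; [okc1 | okc1 | exact: prime_ideal_n1 | rewrite mul0r mulr0]].
- move=> x y [hx [s [w [hs hw ns e]]]] [hy [s' [w' [hs' hw' ns' e']]]].
  split; first by okc1.
  exists (s * s'), (w * s' + w' * s); split; [by okc1 | by okc1 | exact: prime_ideal_nM |].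
  have -> : (x + y) * (s * s') = (x * s) * s' + (y * s') * s by ring.
  by rewrite e e'; ring.
- move=> x y hx [hy [s [w [hs hw ns e]]]]; split; first by okc1.
  by exists s, (x * w); split; [okc1 | okc1 | | rewrite -mulrA e; ring].
Qed.

Lemma val_geM {x y n m} : val_ge n x -> val_ge m y -> val_ge (n + m) (x * y).
Proof.
move=> [hx [s [w [hs hw ns e]]]] [hy [s' [w' [hs' hw' ns' e']]]].
split; first by okc1.
exists (s * s'), (w * w'); split; [by okc1 | by okc1 | exact: prime_ideal_nM |].
by rewrite exprD mulrACA e e'; ring.
Qed.

Lemma val_ge_ideal_mul (I J : algC -> Prop) n m x :
  (forall y, I y -> val_ge n y) -> (forall y, J y -> val_ge m y) ->
  ideal_mul r1 I J x -> val_ge (n + m) x.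
Proof.
move=> hI hJ; apply; first exact: val_ge_ideal.
by move=> i j /hI hi /hJ hj; exact: val_geM.
Qed.

Lemma val_ge0 {x} : OK1 x -> val_ge 0 x.
Proof.
by move=> hx; split=> //; exists 1, x; split=> //; [okc1 | exact: prime_ideal_n1 | rewrite mulr1 mul1r].
Qed.

Lemma val_ge_ideal_pow (I : algC -> Prop) n k x :
  (forall y, I y -> val_ge n y) -> ideal_pow r1 I k x -> val_ge (k * n) x.
Proof.
move=> hI; elim: k x => [|k IH] x /=; first exact: val_ge0.
by rewrite mulSn addnC; exact: val_ge_ideal_mul.
Qed.

Lemma ideal_pow_mem (I : algC -> Prop) k x : I x -> ideal_pow r1 I k (x ^+ k).
Proof.
move=> hI; elim: k => [|k IH] /=; first by okc1.
by rewrite exprSr => L hL; apply.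
Qed.

(** The valuation of an ideal is the least valuation of its elements, and it is attained. *)
Lemma val_ideal (B : algC -> Prop) : ideal r1 B -> (exists b, B b /\ b != 0) ->
  exists n, (forall b, B b -> val_ge n b) /\ (exists b, B b /\ val_at b n).
Proof.
move=> [BO B0 BD BM] [b [Bb b0]]; have [n vn] := val_at_exists (BO _ Bb) b0.
elim/ltn_ind: n b Bb {b0} vn => n IH b Bb vn.
have [[c [m [Bc lt vm]]]|H] := boolp.EM (exists c m, [/\ B c, (m < n)%N & val_at c m]).
  exact: (IH m lt c).
exists n; split; last by exists b.
move=> c Bc; have hc := BO _ Bc; have [->|c0] := eqVneq c 0; first by case: (val_ge_ideal n).
have [m vm] := val_at_exists hc c0.
have le : (n <= m)%N by rewrite leqNgt; apply/negP => lt; apply: H; exists c, m.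
case: vm => s [w [hs hw ns nw e]]; split=> //; exists s, (q ^+ (m - n) * w).
by split=> //; [have := in_OkX (m - n) q_Ok => ?; okc1 | rewrite e -{1}(subnKC le) exprD mulrA].
Qed.

(* [P] is a unit ideal at [Q], so the valuation of [alpha] is [b] times that of [B]. *)
Lemma val_at_ideal_product (P B : algC -> Prop) a b alpha p :
  ideal r1 P -> ideal r1 B -> (exists x, B x /\ x != 0) -> P p -> ~ Q p ->
  OK1 alpha -> alpha != 0 -> (3 %| b)%N ->
  ideal_eq (principal r1 alpha) (ideal_mul r1 (ideal_pow r1 P a) (ideal_pow r1 B b)) ->
  exists n, (3 %| n)%N /\ val_at alpha n.
Proof.
move=> iP iB B0 Pp nQp ha a0 b3 e.
have [n [hB [c [Bc vc]]]] := val_ideal B iB B0.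
have PO y : P y -> OK1 y by case: iP => h _ _ _; exact: h.
have BO y : B y -> OK1 y by case: iB => h _ _ _; exact: h.
have ge : val_ge (a * 0 + b * n) alpha.
  have /e : principal r1 alpha alpha by exists 1; split; [okc1 | rewrite mulr1].
  by apply: val_ge_ideal_mul => y; apply: val_ge_ideal_pow => // z /PO /val_ge0.
(* [ge] bounds the valuation of [alpha] below by [b n]. This multiple of [alpha] has valuation
   exactly [b n] and bounds it above. *)
have [y [hy ey]] : principal r1 alpha (p ^+ a * c ^+ b).
  by apply/e => L hL; apply; exact: ideal_pow_mem.
have [k vk] := val_at_exists ha a0.
have v1 := val_atM (val_atX a (val_at_nQ (PO _ Pp) nQp)) (val_atX b vc).
have y0 : y != 0 by apply/eqP => y0; have := val_at_neq0 v1; rewrite ey y0 mulr0 eqxx.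
have [j vj] := val_at_exists hy y0.
have v2 := val_atM vk vj; rewrite -ey in v2.
have hp := PO _ Pp; have hc := BO _ Bc.
have h12 := val_at_uniq (OK1M (OK1X a hp) (OK1X b hc)) v1 v2.
have le := val_ge_le vk ge.
exists k; split=> //; suff -> : k = (b * n)%N by rewrite dvdn_mulr.
by move: le h12; lia.
Qed.

End PrimeAbove.

(** * Existence of primes, Hilbert 90 and cube classes *)

Lemma prime_ideal_above {q} : prime_Ok q -> exists Q, prime_ideal r1 Q /\ Q q.
Proof.
move=> [hq q0 qn1 _].
have n1 : ~ principal r1 q 1.
  case=> y [hy e]; apply: qn1; exists y; split=> //; split; last exact: hy.2.
  have -> : y = q^-1 by apply: (mulfI q0); rewrite -e divff.
  exact: in_kV hq.1.
pose proper I := [/\ ideal r1 I, I q & ~ I 1].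
have [|A [PA maxA]] := classical_sets.Zorn_bigcup (P := fun I => (forall x, ~ I x) \/ proper I).
  move=> F FP tot; have [[X [FX [x0 Xx0]]]|H] := boolp.EM (exists X, F X /\ exists x, X x); last first.
    by left=> x [X FX Xx]; apply: H; exists X; split=> //; exists x.
  have prop Y y : F Y -> Y y -> proper Y by move=> /FP[H|//] Yy; case: (H y).
  have [[XO X0 XD XM] Xq X1] := prop _ _ FX Xx0.
  right; split; first split.
  - by move=> y [Y FY Yy]; have [[h _ _ _] _ _] := prop _ _ FY Yy; exact: h.
  - by exists X.
  - move=> y z [Y FY Yy] [Z FZ Zz].
    have [[_ _ YD _] _ _] := prop _ _ FY Yy; have [[_ _ ZD _] _ _] := prop _ _ FZ Zz.
    by have [sub|sub] := tot _ _ FY FZ; [exists Z => //; apply: ZD => //; exact: sub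
                                        |exists Y => //; apply: YD => //; exact: sub].
  - move=> y z hy [Z FZ Zz]; exists Z => //.
    by have [[_ _ _ h] _ _] := prop _ _ FZ Zz; exact: h.
  - by exists X.
  - by case=> Y FY Y1; have [_ _] := prop _ _ FY Y1.
have [[AO A0 AD AM] Aq A1] : proper A.
  case: PA => // A0; exfalso; apply: (maxA (principal r1 q)).
    split; first by move=> x /A0.
    by move/(_ q) => h; apply: (A0 q); apply: h; exists 1; split; [okc1 | rewrite mulr1].
  right; split=> //; first split.
  - by move=> x [y [hy ->]]; okc1.
  - by exists 0; split; [okc1 | rewrite mulr0].
  - by move=> x y; exact: principalD.
  - by move=> x y; exact: principalMl.
  - by exists 1; split; [okc1 | rewrite mulr1].
exists A; split=> //; split=> // x y hx hy Axy.
have [Ax|nAx] := boolp.EM (A x); [by left | right].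
apply: boolp.contrapT => nAy.
(* If [A + (x)] contained [1 = a + o x], then [y = a y + o x y] would be in [A]; so it is proper and
   larger than [A]. *)
apply: (maxA (fun z => exists a o, [/\ A a, OK1 o & z = a + o * x])).
  split; first by move=> z Az; exists z, 0; split; [| okc1 | rewrite mul0r addr0].
  by move/(_ x) => h; apply: nAx; apply: h; exists 0, 1; split; [| okc1 | rewrite mul1r add0r].
right; split; first split.
- by move=> z [a [o [Aa ho ->]]]; have ha := AO _ Aa; okc1.
- by exists 0, 0; split; [| okc1 | rewrite mul0r addr0].
- move=> z z' [a [o [Aa ho ->]]] [a' [o' [Aa' ho' ->]]].
  by exists (a + a'), (o + o'); split; [exact: AD | okc1 | ring].
- move=> z z' hz [a [o [Aa ho ->]]].
  by exists (z * a), (z * o); split; [exact: AM | okc1 | ring].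
- by exists q, 0; split; [| okc1 | rewrite mul0r addr0].
- case=> a [o [Aa ho e]]; apply: nAy.
  rewrite -[y]mul1r e mulrDl; apply: AD; first by rewrite mulrC; exact: AM.
  by rewrite -mulrA; exact: AM.
Qed.

(** The resolvent [D x] satisfies [g tau(D x) = D x]; it remains to find [x] among [1, r1, r1 ^ 2]
    with [D x] nonzero. *)
Lemma hilbert90 {g} : K1 g -> g * tau g * tau (tau g) = 1 ->
  exists d, [/\ K1 d, d != 0 & g = d / tau d].
Proof.
move=> hg ng; have hg1 := K1_tau hg; have hz := in_k_zeta3; have z3 := zeta3_cube.
have z2 := zeta3_sqr; have r0 := r1_neq0.
pose D x := x + g * tau x + g * tau g * tau (tau x).
have H x : K1 x -> D x != 0 -> exists d, [/\ K1 d, d != 0 & g = d / tau d].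
  move=> hx d0; have hx1 := K1_tau hx; have hx2 := K1_tau hx1.
  have hgg := K1M hg hg1; have h1 := K1M hg hx1; have h2 := K1M hgg hx2.
  have hD : K1 (D x) by apply: K1D => //; exact: K1D.
  exists (D x); split=> //.
  have e : g * tau (D x) = D x.
    rewrite (tauD (K1D hx h1) h2) (tauD hx h1) (tauM hg hx1) (tauM hgg hx2) (tauM hg hg1) (tau3 hx).
    have -> : g * (tau x + tau g * tau (tau x) + tau g * tau (tau g) * x)
      = g * tau x + g * tau g * tau (tau x) + g * tau g * tau (tau g) * x by ring.
    by rewrite ng /D; ring.
  by rewrite -{1}e mulfK // (tau_eq0 hD).
have t1 : tau r1 = zeta3 * r1 := tau_r1.
have t2 : tau (tau r1) = zeta3 ^+ 2 * r1 by rewrite t1 (tauM (K1_k hz) K1_r1) t1 (tau_k hz); ring.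
have hr := K1_r1; have hr1 := K1_tau hr.
have [/eqP d1|] := boolP (D 1 == 0); last by apply: H; exact: K1_k in_k1.
have [/eqP d2|] := boolP (D r1 == 0); last exact: H.
have [/eqP d3|] := boolP (D (r1 ^+ 2) == 0); last by apply: H; exact: K1X.
exfalso; move: d1 d2 d3; rewrite /D !(tau_k in_k1) !(tauX _ hr) (tauX _ hr1) t2 t1 => d1 d2 d3.
(* In [r1 ^ 2 D(1) + r1 D(r1) + D(r1 ^ 2)] the coefficients of [g] and [g tau g] contain
   [1 + zeta3 + zeta3 ^ 2 = 0]. *)
have : 3 * r1 ^+ 2 = 0.
  transitivity (r1 ^+ 2 * 0 + r1 * 0 + 0 : algC); last by ring.
  rewrite -{1}d1 -{1}d2 -d3; ring: z2.
by apply/eqP; rewrite mulf_neq0 ?pnatr_eq0 // expf_neq0.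
Qed.

Lemma k_denominator {x} : in_k x -> exists n, [/\ in_Ok n, n != 0 & in_Ok (n * x)].
Proof.
have den (a : rat) : ratr a * (denq a)%:~R = (numq a)%:~R :> algC.
  by rewrite -[a in ratr a]divq_num_den rmorphM fmorphV /= !ratr_int mulfVK // intr_eq0 denq_neq0.
case=> a [b ->]; exists ((denq a)%:~R * (denq b)%:~R); split.
- by apply: in_OkM; exact: in_Ok_int.
- by rewrite mulf_neq0 // intr_eq0 denq_neq0.
have -> : (denq a)%:~R * (denq b)%:~R * (ratr a + ratr b * zeta3)
  = (ratr a * (denq a)%:~R) * (denq b)%:~R + (denq a)%:~R * (ratr b * (denq b)%:~R) * zeta3 :> algC by ring.
have hi := in_Ok_int; rewrite !den; apply: in_OkD; last by apply: in_OkM; [exact: in_OkM | okc].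
exact: in_OkM.
Qed.

Lemma K1_denominator {x} : K1 x -> exists n, [/\ in_Ok n, n != 0 & OK1 (n * x)].
Proof.
case=> a [b [c [/k_denominator[n [hn n0 ha]] /k_denominator[m [hm m0 hb]] /k_denominator[k [hk k0 hc]] ->]]].
exists (n * m * k); split; [by okc | by rewrite !mulf_neq0 |].
have -> : n * m * k * (a + b * r1 + c * r1 ^+ 2) =
  m * k * (n * a) + n * k * (m * b) * r1 + n * m * (k * c) * r1 ^+ 2 by ring.
by okc1.
Qed.

(* If [G] has valuation divisible by 3 at some prime above each [q], then so has any [m] in [k]
   in its cube class, and prime factors of [m] can be removed three at a time; [pi1] itself is
   a cube in [K1]. *)
Lemma cube_class_unit (G : algC) : OK1 G ->
  (forall q, prime_Ok q -> ~ dvd_Ok q pi1 ->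
     exists Q n, [/\ prime_ideal r1 Q, Q q, (3 %| n)%N & val_at q Q G n]) ->
  forall m w, in_Ok m -> m != 0 -> K1 w -> w != 0 -> G = m * w ^+ 3 ->
  exists u w', [/\ in_Ok u, dvd_Ok u 1, K1 w' & G = u * w' ^+ 3].
Proof.
move=> hG HG m; have [k] := ubnP (normk m); elim: k m => // k IH m mk w hm m0 hw w0 e.
have [m1|m1] := boolp.EM (dvd_Ok m 1); first by exists m, w.
have [q [hq [m' [hm' em]]]] := prime_Ok_factor _ hm m0 m1.
have [hqO q0 qn1 qp] := hq.
have lt d m'' : in_Ok d -> in_Ok m'' -> ~ dvd_Ok d 1 -> m = d * m'' -> (normk m'' < k)%N /\ m'' != 0.
  move=> hd hm'' nd ed; have m''0 : m'' != 0 by apply: contraNneq m0 => h; rewrite ed h mulr0.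
  split=> //; rewrite -ltnS; apply: leq_trans mk; rewrite ed normkM // ltnS.
  have : normk m'' != 0%N by rewrite normk_eq0.
  have : normk d != 0%N by rewrite normk_eq0 //; apply: contraNneq m0 => h; rewrite ed h mul0r.
  have : normk d <> 1%N by move/(normk1_unit hd).
  nia.
(* A factor associate to [pi1 = r1 ^ 3] is absorbed into the cube, with no condition on
   valuations. *)
have [[p [hp ep]]|nqp] := boolp.EM (dvd_Ok q pi1).
  have [_ p0 pn1 pp] := pi1_prime; have hp1 := in_Ok_pi1.
  have [[q' [hq' eq']]|[p' [hp' ep']]] : dvd_Ok pi1 q \/ dvd_Ok pi1 p.
    by apply: pp => //; rewrite -ep; exact: dvd_Ok_refl.
    have em'' : m = pi1 * (q' * m') by rewrite em eq' mulrA.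
    have [l1 l2] := lt _ _ hp1 (in_OkM hq' hm') pn1 em''.
    apply: (IH (q' * m') l1 (r1 * w)); try okc; first exact: (K1M K1_r1 hw).
      by rewrite mulf_neq0 // r1_neq0.
    by rewrite e em'' -r1E; ring.
  case: qn1; exists p'; split=> //; apply: (mulfI p0); rewrite mulr1 {1}ep ep'; ring.
have [Q [n [hQ Qq n3 vn]]] := HG q hq nqp.
have [d [hd d0 hdw]] := K1_denominator hw.
have [a va] := val_at_exists q Q hq nqp hQ Qq hdw (mulf_neq0 d0 w0).
have [b vb] := val_at_exists q Q hq nqp hQ Qq (OK1_Ok hd) d0.
have [c vc] := val_at_exists q Q hq nqp hQ Qq (OK1_Ok hm) m0.
have v1 := val_atM q Q hQ vn (val_atX q Q hQ 3 vb).
have v2 := val_atM q Q hQ vc (val_atX q Q hQ 3 va).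
(* Valuations exist on integers only, so [d] clears the denominator of [w]. Comparison gives
   [n + 3 b = c + 3 a], hence [3 | c]; as [c > 0], [q ^+ 3] can be removed from [m]. *)
have e' : G * d ^+ 3 = m * (d * w) ^+ 3 by rewrite e; ring.
rewrite e' in v1.
have hmd : OK1 (m * (d * w) ^+ 3) by okc1.
have h3 := val_at_uniq q Q hq hQ Qq hmd v1 v2.
have c1 : (0 < c)%N.
  rewrite lt0n; apply/negP => /eqP c0; move: vc; rewrite c0 => -[s [v [hs hv ns nv]]].
  rewrite expr0 mul1r => ev; apply: nv; rewrite -ev em.
  by apply: (prime_idealMr Q hQ) => //; apply: (prime_idealMr Q hQ) => //; okc1.
have [m'' [hm'' em'']] := val_ge_Ok_dvd q Q hq hQ Qq c hm (val_atW q Q (OK1_Ok hm) vc).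
have c3 : c = (3 + (c - 3))%N by lia.
have em3 : m = q ^+ 3 * (q ^+ (c - 3) * m'') by rewrite em'' mulrA -exprD -c3.
have hmO : in_Ok (q ^+ (c - 3) * m'') by okc.
have nq3 : ~ dvd_Ok (q ^+ 3) 1.
  by case=> z [hz ez]; apply: qn1; exists (q ^+ 2 * z); split; [okc | rewrite ez; ring].
have [l1 l2] := lt _ _ (in_OkX 3 hqO) hmO nq3 em3.
apply: (IH _ l1 (q * w)) => //; first exact: (K1M (K1_k hqO.1) hw).
  by rewrite mulf_neq0.
by rewrite e {1}em3; ring.
Qed.

(** * Admissible elements *)

Section Admissible.

Variables (pi2 : algC) (P : algC -> Prop).
Hypotheses (pi2_prime : prime_Ok pi2) (pi12 : ~ (dvd_Ok pi1 pi2 /\ dvd_Ok pi2 pi1)).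
Hypotheses (pi2_3 : ~ dvd_Ok pi2 3) (pi2_primary : primary pi2).
Hypotheses (pi1_cube : cube_in_completion pi2 pi1).
Hypotheses (P_prime : prime_ideal r1 P) (P_pi2 : P pi2).

Lemma in_Ok_pi2 : in_Ok pi2. Proof. by case: pi2_prime. Qed.

Lemma prime_dvd_sym {p q} : prime_Ok p -> prime_Ok q -> dvd_Ok q p -> dvd_Ok p q.
Proof.
case=> hp p0 _ pp [hq q0 qn1 _] [e [he ep]].
have [//|[f [hf ef]]] : dvd_Ok p q \/ dvd_Ok p e.
  by apply: pp => //; rewrite -ep; exact: dvd_Ok_refl.
by case: qn1; exists f; split=> //; apply: (mulfI p0); rewrite mulr1 {1}ep ef; ring.
Qed.

Lemma pi2_ndvd_pi1 : ~ dvd_Ok pi2 pi1.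
Proof. by move=> h; apply: pi12; split=> //; exact: prime_dvd_sym pi1_prime pi2_prime h. Qed.

(* [pi1] is a cube modulo [pi2], so [P] contains some [f = y - zeta3 ^ i c r1] with [y, c] in [k],
   and [tau f] differs from [f] by a factor prime to [pi2]. *)
Lemma P_moved_by_tau : exists f, [/\ P f, ~ P (tau f) & ~ P (tau (tau f))].
Proof.
have hz := in_k_zeta3; have z2 := zeta3_sqr; have z3 := zeta3_cube.
have h1 := in_Ok_pi1; have h2 := in_Ok_pi2.
(* Precision 1 suffices: clearing the denominator [c], [y c] is integral and its cube is [pi1 c ^ 3]
   modulo [pi2]. *)
have [y [hy [b [c [hb hc nc e]]]]] := pi1_cube 1.
have eY : (y * c) ^+ 3 = pi1 * c ^+ 3 + pi2 * (b * c ^+ 2).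
  have -> : (y * c) ^+ 3 = pi1 * c ^+ 3 + (y ^+ 3 - pi1) * c * c ^+ 2 by ring.
  by rewrite e; ring.
have hY : in_Ok (y * c).
  split; first by apply: in_kM; [|case: hc].
  apply: Aint_cube; rewrite eY.
  suff : in_Ok (pi1 * c ^+ 3 + pi2 * (b * c ^+ 2)) by case.
  by okc.
(* The factors of [(y c) ^ 3 - pi1 c ^ 3], which lies in [P]; [tau] shifts the index. *)
pose f i := y * c - zeta3 ^+ i * c * r1.
have hf i : OK1 (f i) by rewrite /f; okc1.
have tf i : tau (f i) = f i.+1.
  have hc1 : in_k (zeta3 ^+ i * c) by apply: in_kM; [exact: in_kX | exact: hc.1].
  rewrite /f (tauD (K1_k hY.1) (K1N (K1M (K1_k hc1) K1_r1))) (tau_k hY.1) -mulNr.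
  rewrite (tauM (K1_k (in_kN hc1)) K1_r1) (tau_k (in_kN hc1)) tau_r1 exprS; ring.
have [i Pi] : exists i, P (f i).
  have : P (f 0%N * (f 1%N * f 2%N)).
    have -> : f 0%N * (f 1%N * f 2%N) = pi2 * (b * c ^+ 2).
      transitivity ((y * c) ^+ 3 - r1 ^+ 3 * c ^+ 3); last by rewrite eY r1E; ring.
      rewrite /f; ring: z2.
    by apply: (prime_idealMr P P_prime) => //; okc1.
  case/(prime_idealM_or P P_prime (hf _) (OK1M (hf _) (hf _))) => [?|]; first by exists 0%N.
  by case/(prime_idealM_or P P_prime (hf _) (hf _)) => ?; [exists 1%N | exists 2%N].
have nPc : ~ P c by move/(prime_ideal_Ok_dvd P P_prime pi2_prime P_pi2 hc).
have nPr : ~ P r1.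
  move=> Pr; apply: pi2_ndvd_pi1; apply: (prime_ideal_Ok_dvd P P_prime pi2_prime P_pi2 h1).
  by rewrite -r1E exprS; apply: (prime_idealMr P P_prime) => //; okc1.
have nP3 : ~ P 3 by move/(prime_ideal_Ok_dvd P P_prime pi2_prime P_pi2 (in_Ok_nat 3)).
have nPd v : OK1 v -> P (v * (zeta3 ^+ i * c * r1)) -> P v.
  move=> hv; have hzc : OK1 (zeta3 ^+ i) by okc1.
  case/(prime_idealM_or P P_prime hv _) => //; first by okc1.
  case/(prime_idealM_or P P_prime _ OK1_r1) => //; first by okc1.
  case/(prime_idealM_or P P_prime hzc (OK1_Ok hc)) => // Pz.
  case: (prime_ideal_n1 P P_prime); rewrite -(expr1n _ i) -z3 -exprM mulnC exprM exprS.
  by apply: (prime_idealMr P P_prime) => //; okc1.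
exists (f i); rewrite !tf; split=> // h.
  have : P (f i - f i.+1) by exact: (prime_idealB P P_prime).
  have -> : f i - f i.+1 = (zeta3 - 1) * (zeta3 ^+ i * c * r1) by rewrite /f exprS; ring.
  move/nPd => hP; apply: nP3.
  have -> : 3 = (zeta3 - 1) * (zeta3 ^+ 2 - 1) by ring: z2.
  by apply: (prime_idealMr P P_prime); [okc1 | apply: hP; okc1].
have : P (f i - f i.+2) by exact: (prime_idealB P P_prime).
have -> : f i - f i.+2 = (zeta3 ^+ 2 - 1) * (zeta3 ^+ i * c * r1) by rewrite /f !exprS; ring.
move/nPd => hP; apply: nP3.
have -> : 3 = (zeta3 - 1) * (zeta3 ^+ 2 - 1) by ring: z2.
by apply: (prime_idealMl P P_prime); [okc1 | apply: hP; okc1].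
Qed.

(** If [q] is associate to [pi2], take [Q = tau^-1 P] with the element moved by [tau]; otherwise
    [pi2], which is in [P] and fixed by [tau], is outside [Q]. The two witnesses serve [alpha] and
    [tau alpha] respectively. *)
Lemma prime_ideal_avoiding {q} : prime_Ok q -> exists Q,
  [/\ prime_ideal r1 Q, Q q, exists p, P p /\ ~ Q p & exists p, P p /\ ~ Q (tau p)].
Proof.
move=> hq; have hqO : in_Ok q by case: hq.
have hP y : P y -> OK1 y by move/(prime_ideal_OK1 P P_prime).
have [d2|nd2] := boolp.EM (dvd_Ok q pi2).
  have [g [hg eg]] := prime_dvd_sym pi2_prime hq d2.
  have [f [Pf n1 n2]] := P_moved_by_tau; exists (fun x => OK1 x /\ P (tau x)); split.
  - exact: prime_ideal_tau.
  - by split; [okc1 | rewrite (tau_k hqO.1) eg; apply: (prime_idealMr P P_prime) => //; okc1].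
  - by exists f; split=> // -[].
  - by exists f; split=> // -[].
have [Q [hQ Qq]] := prime_ideal_above hq.
have nQ : ~ Q pi2 by move/(prime_ideal_Ok_dvd Q hQ hq Qq in_Ok_pi2).
exists Q; split=> //; exists pi2; split=> //.
by rewrite (tau_k in_Ok_pi2.1).
Qed.

Lemma coprime_to_3_neq0 B : coprime_to_3 r1 B -> exists x, B x /\ x != 0.
Proof.
case=> b [c [Bb hc e]]; exists b; split=> //; apply/eqP => b0.
have [_ _ nl _] := prime_sqrtm3; apply: nl; exists (- (sqrtm3 * c)).
have l2 := sqrtm3_sqr; move: e; rewrite b0 add0r => e.
split; last by rewrite e; ring: l2.
suff hcO : in_Ok c by okc.
split; last exact: hc.2.
have -> : c = 3^-1 by apply: (@mulfI _ 3); rewrite ?pnatr_eq0 // -e divff ?pnatr_eq0.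
by apply: in_kV; exact: in_k_nat.
Qed.

Lemma admissible_val {q Q theta} : prime_Ok q -> ~ dvd_Ok q pi1 -> prime_ideal r1 Q -> Q q ->
  (exists p, P p /\ ~ Q p) -> (exists p, P p /\ ~ Q (tau p)) ->
  admissible r1 pi2 tau P theta -> exists n, (3 %| n)%N /\ val_at q Q theta n.
Proof.
move=> hq nq hQ Qq [p [Pp nQp]] [p' [Pp' nQp']].
have hqO : in_Ok q by case: hq.
case=> hth [[c [alpha [c3 ha eth [beta [hb b0 eN]] [a [b [B [iB cB _ b3 e]]]]]]] _].
have a0 : alpha != 0.
  apply: contraTneq (eqxx (pi2 * beta ^+ 3)) => a0.
  by rewrite -{1}eN a0 !mul0r eq_sym mulf_neq0 ?expf_neq0 //; case: pi2_prime.
have iP : ideal r1 P by case: P_prime.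
have B0 := coprime_to_3_neq0 _ cB.
have [n [n3 vn]] := val_at_ideal_product q Q hq nq hQ Qq P B a b alpha p iP iB B0 Pp nQp ha a0 b3 e.
have hQ' := prime_ideal_tau Q hQ.
have Q'q : OK1 q /\ Q (tau q) by split; [okc1 | rewrite (tau_k hqO.1)].
have nQ'p' : ~ (OK1 p' /\ Q (tau p')) by case.
have [m [m3 vm]] := val_at_ideal_product q _ hq nq hQ' Q'q P B a b alpha p' iP iB B0 Pp' nQ'p' ha a0 b3 e.
have vt : val_at q Q (tau alpha) m.
  case: vm => s [w [hs hw ns nw es]]; exists (tau s), (tau w).
  split; [by okc1 | by okc1 | by move=> h; apply: ns | by move=> h; apply: nw |].
  rewrite -(tauM ha.1 hs.1) es (tauM (K1_k (in_kX _ hqO.1)) hw.1) tau_k //.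
  exact: in_kX hqO.1.
have vz : val_at q Q (zeta3 ^+ c) 0.
  apply: val_at_nQ => //; first by okc1.
  move=> h; apply: (prime_ideal_n1 Q hQ); have -> : 1 = zeta3 ^+ c * (zeta3 ^+ c) ^+ 2.
    by rewrite -exprS -exprM mulnC exprM zeta3_cube expr1n.
  by apply: (prime_idealMr Q hQ) => //; okc1.
exists (0 + 2 * n + m)%N; split; first by rewrite add0n dvdn_add // dvdn_mull.
by rewrite eth; apply: val_atM => //; apply: val_atM => //; exact: val_atX.
Qed.

Lemma admissible_cube_class {theta theta'} :
  admissible r1 pi2 tau P theta -> admissible r1 pi2 tau P theta' ->
  exists m w, [/\ in_k m, m != 0, K1 w, w != 0 & theta ^+ 2 * theta' = m * w ^+ 3].
Proof.
case=> hth [[c [alpha [_ ha eth [beta [hb b0 eN]] _]]] _].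
case=> hth' [[c' [alpha' [_ ha' eth' [beta' [hb' b0' eN']] _]]] _].
have p20 : pi2 != 0 by case: pi2_prime.
have n0 : alpha * tau alpha * tau (tau alpha) != 0 by rewrite eN mulf_neq0 // expf_neq0.
have n0' : alpha' * tau alpha' * tau (tau alpha') != 0 by rewrite eN' mulf_neq0 // expf_neq0.
move: (n0) (n0'); rewrite !mulf_eq0 !negb_or => /andP[/andP[a0 a1] a2] /andP[/andP[a0' a1'] a2'].
have k0 := ha.1; have k1 := K1_tau k0; have k0' := ha'.1; have k1' := K1_tau k0'.
pose b := beta' / beta.
have hbk : in_k b by apply: in_kM => //; exact: in_kV.
have hbb : b != 0 by rewrite mulf_neq0 // invr_eq0.
pose g := alpha' / alpha / b.
have hga : K1 (alpha' / alpha) := K1M k0' (K1V k0).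
have hg : K1 g := K1M hga (K1V (K1_k hbk)).
have tg : tau g = tau alpha' / tau alpha / b.
  by rewrite /g (tauM hga (K1V (K1_k hbk))) (tauM k0' (K1V k0)) (tauV k0) (tauV (K1_k hbk)) (tau_k hbk).
have ttg : tau (tau g) = tau (tau alpha') / tau (tau alpha) / b.
  have hga1 : K1 (tau alpha' / tau alpha) := K1M k1' (K1V k1).
  by rewrite tg (tauM hga1 (K1V (K1_k hbk))) (tauM k1' (K1V k1)) (tauV k1) (tauV (K1_k hbk)) (tau_k hbk).
have ng : g * tau g * tau (tau g) = 1.
  rewrite ttg tg /g.
  transitivity ((alpha' * tau alpha' * tau (tau alpha')) / (alpha * tau alpha * tau (tau alpha)) / b ^+ 3).
    by field; rewrite a0 a1 a2 hbb.
  by rewrite eN eN' /b; field; rewrite b0 b0' p20.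
have [d [hd d0 ed]] := hilbert90 hg ng.
have hd1 := K1_tau hd.
have d1 : tau d != 0 by rewrite (tau_eq0 hd).
have d2 : tau (tau d) != 0 by rewrite (tau_eq0 hd1).
have z0 := zeta3_neq0.
have ed1 : tau g = tau d / tau (tau d) by rewrite ed (tauM hd (K1V hd1)) (tauV hd1).
have th0 : theta != 0 by rewrite eth !mulf_neq0 // ?expf_neq0.
exists (zeta3 ^+ c' / zeta3 ^+ c / (d * tau d * tau (tau d))), (theta * b * d); split.
- apply: in_kM; last by apply: in_kV; exact: norm_k.
  by apply: in_kM; [|apply: in_kV]; apply: in_kX; exact: in_k_zeta3.
- by rewrite !mulf_neq0 ?invr_eq0 ?expf_neq0 // !mulf_neq0.
(* The witnesses come from [alpha' = alpha b d / tau d]: the factor [(d / tau d) ^ 2 tau(d / tau d)]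
   equals [d ^ 3 / N d]. *)
- exact: (K1M (K1M hth.1 (K1_k hbk)) hd).
- exact: (mulf_neq0 (mulf_neq0 th0 hbb) d0).
have ea : alpha' = alpha * b * (d / tau d) by rewrite -ed /g; field; rewrite a0 hbb.
have et : tau alpha' = tau alpha * b * (tau d / tau (tau d)) by rewrite -ed1 tg; field; rewrite a1 hbb.
have -> : (theta * b * d) ^+ 3 = (zeta3 ^+ c * alpha ^+ 2 * tau alpha) * theta ^+ 2 * (b * d) ^+ 3.
  by rewrite -eth; ring.
rewrite eth' et ea.
by field; rewrite d0 d1 d2 expf_neq0.
Qed.

(** [alpha] divides [pi2 ^ a b1 ^ b], where [pi2] is 1 modulo [sqrt(-3)] and [b1] in [B] is 1 modulo
    3. The argument is run at [Q] and at [tau^-1 Q], for [alpha] and [tau alpha]. *)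
Lemma admissible_unit_sqrtm3 {Q theta} : prime_ideal r1 Q -> Q sqrtm3 ->
  admissible r1 pi2 tau P theta -> ~ Q theta.
Proof.
move=> hQ Ql [hth [[c [alpha [_ ha eth _ [a [b [B [iB [b1 [c1 [Bb1 hc1 e1]]] _ _ e]]]]]]] _]].
have l2 := sqrtm3_sqr; have hl := in_Ok_sqrtm3; have hz := zeta3_cube.
have nQ2 : ~ Q pi2.
  move/(prime_ideal_Ok_dvd Q hQ prime_sqrtm3 Ql in_Ok_pi2) => -[z [hz' ez]].
  have [z' [hz'' ez']] := pi2_primary; have [_ _ nl _] := prime_sqrtm3; apply: nl.
  exists (z - 3 * z'); split; first by okc.
  transitivity (pi2 - (pi2 - 1)); first by ring.
  by rewrite ez' {1}ez; ring.
have hb1 : OK1 b1 by case: iB => h _ _ _; exact: h.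
have nA R : prime_ideal r1 R -> R sqrtm3 -> ~ R pi2 -> ~ R alpha.
  move=> hR Rl nR2 Ra.
  have nRb : ~ R b1.
    move=> Rb; apply: (prime_ideal_n1 R hR); rewrite e1; apply: (prime_idealD R hR) => //.
    have -> : 3 * c1 = sqrtm3 * (- (sqrtm3 * c1)) by ring: l2.
    by apply: (prime_idealMr R hR) => //; okc1.
  have [y [hy ey]] : principal r1 alpha (pi2 ^+ a * b1 ^+ b).
    by apply/e => L hL; apply; exact: ideal_pow_mem.
  have hp2 := OK1_Ok in_Ok_pi2.
  apply: (prime_ideal_nM R hR (OK1X a hp2) (OK1X b hb1) (prime_ideal_nX R hR a hp2 nR2) (prime_ideal_nX R hR b hb1 nRb)).
  by rewrite ey; exact: (prime_idealMr R hR).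
have na := nA Q hQ Ql nQ2.
have nta : ~ Q (tau alpha).
  move=> Qt; apply: (nA _ (prime_ideal_tau Q hQ)); last by split.
    by split; [okc1 | rewrite (tau_k hl.1)].
  by case=> _; rewrite (tau_k in_Ok_pi2.1).
have hth1 := OK1_tau ha.
rewrite eth; apply: (prime_ideal_nM Q hQ) => //; [by okc1 | apply: (prime_ideal_nM Q hQ); [by okc1 | by okc1 | |]].
  move=> h; apply: (prime_ideal_n1 Q hQ); have -> : 1 = zeta3 ^+ c * (zeta3 ^+ c) ^+ 2.
    by rewrite -exprS -exprM mulnC exprM hz expr1n.
  by apply: (prime_idealMr Q hQ) => //; okc1.
exact: (prime_ideal_nX Q hQ).
Qed.

Lemma admissible_neq0 {theta} : admissible r1 pi2 tau P theta -> theta != 0.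
Proof.
move=> ad; have [Q [hQ Ql]] := prime_ideal_above prime_sqrtm3.
by apply/eqP => th0; apply: (admissible_unit_sqrtm3 hQ Ql ad); rewrite th0; exact: prime_ideal0.
Qed.

Lemma admissible_cube {theta theta'} :
  admissible r1 pi2 tau P theta -> admissible r1 pi2 tau P theta' ->
  exists w, K1 w /\ theta ^+ 2 * theta' = w ^+ 3.
Proof.
move=> ad ad'; have [m [w [hm m0 hw w0 e]]] := admissible_cube_class ad ad'.
have hth : OK1 theta by case: ad.
have hth' : OK1 theta' by case: ad'.
have hG : OK1 (theta ^+ 2 * theta') by okc1.
have l0 := sqrtm3_neq0; have l2 := sqrtm3_sqr; have hl := in_Ok_sqrtm3.
have z2 := zeta3_sqr; have z3 := zeta3_cube; have zn0 := zeta3_neq0.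
have [d [hd d0 hdm]] := k_denominator hm.
(* Multiplying [m] by [d ^ 3] makes it integral without changing its cube class. *)
have [||||||u [w' [hu u1 hw' e']]] := @cube_class_unit _ hG _ (d ^+ 2 * (d * m)) (w / d).
- move=> q hq nq; have [Q [hQ Qq hp hp']] := prime_ideal_avoiding hq.
  have [n [n3 vn]] := admissible_val hq nq hQ Qq hp hp' ad.
  have [n' [n3' vn']] := admissible_val hq nq hQ Qq hp hp' ad'.
  exists Q, (2 * n + n')%N; split=> //; first by rewrite dvdn_add // dvdn_mull.
  by apply: val_atM => //; exact: val_atX.
- by okc.
- by rewrite !mulf_neq0 ?expf_neq0.
- by apply: (K1M hw); apply: K1V; exact: K1_k hd.1.
- by rewrite mulf_neq0 ?invr_eq0.
- by rewrite e; field.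
have [s [i [i3 eu]]] := Ok_units u hu u1.
(* A sign is its own cube, so only the power of [zeta3] remains. *)
pose W := (-1) ^+ s * w'.
have hWK : K1 W by apply: K1M => //; apply: K1X; apply: K1N; exact: K1_k in_k1.
have eW : theta ^+ 2 * theta' = zeta3 ^+ i * W ^+ 3.
  have hs : ((-1) ^+ s) ^+ 3 = (-1) ^+ s :> algC by rewrite -signr_odd; case: (odd s); ring.
  have -> : W ^+ 3 = ((-1) ^+ s) ^+ 3 * w' ^+ 3 by exact: exprMn.
  by rewrite hs e' eu; ring.
have hW : OK1 W.
  split=> //; apply: Aint_cube.
  have -> : W ^+ 3 = (zeta3 ^+ i) ^+ 2 * (theta ^+ 2 * theta').
    by rewrite eW mulrA -exprSr -exprM mulnC exprM z3 expr1n mul1r.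
  suff : OK1 ((zeta3 ^+ i) ^+ 2 * (theta ^+ 2 * theta')) by case.
  by okc1.
exists W; split=> //; case: i i3 eu eW => [|i] i3 eu eW; first by rewrite eW mul1r.
exfalso.
(* For exponents 1 and 2, [zeta3 ^ i - 1] is [sqrt(-3)] times a unit: it is divisible by [sqrt(-3)]
   only once. *)
have [v [v' [hv hv' vv' ez]]] : exists v v',
    [/\ in_Ok v, in_Ok v', v' * v = 1 & zeta3 ^+ i.+1 - 1 = sqrtm3 * v].
  case: i i3 {eu eW} => [|[|//]] _.
    exists (- zeta3 ^+ 2), (- zeta3); split; try okc; first by rewrite mulrNN -exprS.
    by rewrite sqrtm3E; ring: z3 z2.
  exists zeta3, (zeta3 ^+ 2); split; try okc; first by rewrite -exprSr.
  by rewrite sqrtm3E; ring: z2.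
have [Q [hQ Ql]] := prime_ideal_above prime_sqrtm3.
have nl1 : ~ dvd_Ok sqrtm3 pi1.
  move=> [z [hz' ez']]; have [z' [hz'' ez'']] := pi1_primary; have [_ _ nl _] := prime_sqrtm3; apply: nl.
  exists (z - 3 * z'); split; first by okc.
  transitivity (pi1 - (pi1 - 1)); first by ring.
  by rewrite ez'' {1}ez'; ring.
have [eta [z [heta hz' eeta]]] :
    exists eta z, [/\ OK1 eta, OK1 z & eta ^+ 3 - theta = 3 * sqrtm3 * z].
  by case: ad => _ [].
have [eta' [z' [heta' hz'' eeta']]] :
    exists eta z, [/\ OK1 eta, OK1 z & eta ^+ 3 - theta' = 3 * sqrtm3 * z].
  by case: ad' => _ [].
pose h := eta ^+ 2 * eta'.
have hh : OK1 h by rewrite /h; okc1.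
have [Z [hZ eZ]] : exists Z, OK1 Z /\ h ^+ 3 = theta ^+ 2 * theta' + 3 * sqrtm3 * Z.
  exists (eta ^+ 3 * z * eta' ^+ 3 + theta * z * eta' ^+ 3 + theta ^+ 2 * z'); split; first by okc1.
  have -> : theta' = eta' ^+ 3 - 3 * sqrtm3 * z' by rewrite -eeta'; ring.
  have -> : theta = eta ^+ 3 - 3 * sqrtm3 * z by rewrite -eeta; ring.
  by rewrite /h; ring.
have eh : h ^+ 3 - W ^+ 3 = sqrtm3 * (v * W ^+ 3 + 3 * Z).
  have -> : h ^+ 3 - W ^+ 3 = (zeta3 ^+ i.+1 - 1) * W ^+ 3 + 3 * sqrtm3 * Z by rewrite eZ eW; ring.
  by rewrite ez; ring.
(* [h ^ 3 - W ^ 3] is divisible by [sqrt(-3)], hence so is [h - W] by unramifiedness. But then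
   [h ^ 3 - W ^ 3] is divisible by [sqrt(-3) ^ 3], which forces [v W ^ 3] to be divisible by
   [sqrt(-3) ^ 2], although [theta] and [theta'] are units there. *)
have [nu [hnu enu]] : principal r1 sqrtm3 (h - W).
  apply: (principal_reduced sqrtm3 Q prime_sqrtm3 nl1 hQ Ql 3); first by okc1.
  exists (v * W ^+ 3 + 3 * Z + sqrtm3 * (h * W * (h - W))); split; first by okc1.
  have -> : (h - W) ^+ 3 = (h ^+ 3 - W ^+ 3) - 3 * (h * W * (h - W)) by ring.
  by rewrite eh; ring: l2.
have eW3 : W ^+ 3 = sqrtm3 * (sqrtm3 * v' * (Z - W ^+ 2 * nu - sqrtm3 * W * nu ^+ 2 + nu ^+ 3)).
  transitivity (v' * (v * W ^+ 3)); first by rewrite mulrA vv' mul1r.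
  have -> : v * W ^+ 3 = sqrtm3 ^+ 2 * (Z - W ^+ 2 * nu - sqrtm3 * W * nu ^+ 2 + nu ^+ 3).
    apply: (mulfI l0).
    have -> : sqrtm3 * (v * W ^+ 3) = h ^+ 3 - W ^+ 3 - 3 * sqrtm3 * Z by rewrite eh; ring.
    have -> : h = W + sqrtm3 * nu by rewrite -enu; ring.
    have e3 : 3 = - sqrtm3 ^+ 2 by rewrite l2 opprK.
    have -> : (W + sqrtm3 * nu) ^+ 3 = W ^+ 3 + 3 * (W ^+ 2 * (sqrtm3 * nu) + W * (sqrtm3 * nu) ^+ 2)
       + (sqrtm3 * nu) ^+ 3 by ring.
    by rewrite e3; ring.
  by ring.
have QG : Q (theta ^+ 2 * theta').
  rewrite eW eW3; apply: (prime_idealMl Q hQ); first by okc1.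
  by apply: (prime_idealMr Q hQ) => //; okc1.
have nth := admissible_unit_sqrtm3 hQ Ql ad; have nth' := admissible_unit_sqrtm3 hQ Ql ad'.
by apply: (prime_ideal_nM Q hQ _ hth' (prime_ideal_nX Q hQ 2 hth nth) nth' QG); okc1.
Qed.

End Admissible.

End CubicExtension.

(** * Cube roots and generated fields *)

Lemma eq_cube {x y : algC} : x ^+ 3 = y ^+ 3 -> exists i, x = zeta3 ^+ i * y.
Proof.
move=> e; have z2 := zeta3_sqr.
have : (x - y) * ((x - zeta3 * y) * (x - zeta3 ^+ 2 * y)) = 0.
  transitivity (x ^+ 3 - y ^+ 3); last by rewrite e subrr.
  ring: z2.
move/eqP; rewrite !mulf_eq0 !subr_eq0 => /or3P[/eqP h|/eqP h|/eqP h].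
- by exists 0%N; rewrite mul1r.
- by exists 1%N.
- by exists 2%N.
Qed.

Section Subfield.

Variable S : algC -> Prop.
Hypothesis S_subfield : subfield S.

Lemma subfield1 : S 1. Proof. by case: S_subfield. Qed.
Lemma subfieldB {x y} : S x -> S y -> S (x - y).
Proof. by case: S_subfield => _ h _ _; exact: h. Qed.
Lemma subfieldM {x y} : S x -> S y -> S (x * y).
Proof. by case: S_subfield => _ _ h _; exact: h. Qed.
Lemma subfieldV {x} : S x -> S x^-1.
Proof. by case: S_subfield => _ _ _ h; exact: h. Qed.
Lemma subfield0 : S 0. Proof. by rewrite -(subrr 1); apply: subfieldB; exact: subfield1. Qed.
Lemma subfieldN {x} : S x -> S (- x).
Proof. by move=> h; rewrite -sub0r; apply: subfieldB => //; exact: subfield0. Qed.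
Lemma subfieldD {x y} : S x -> S y -> S (x + y).
Proof. by move=> hx hy; rewrite -[y]opprK; apply: subfieldB => //; exact: subfieldN. Qed.
Lemma subfieldX {x} n : S x -> S (x ^+ n).
Proof.
by move=> h; elim: n => [|n IH]; [exact: subfield1 | rewrite exprS; exact: subfieldM].
Qed.
Lemma subfield_int (n : int) : S n%:~R.
Proof.
have Sn (k : nat) : S k%:R.
  elim: k => [|k IH]; first exact: subfield0.
  by rewrite -addn1 natrD; apply: subfieldD => //; exact: subfield1.
by case: n => k; [exact: Sn | rewrite NegzE rmorphN; apply: subfieldN; exact: Sn].
Qed.
Lemma subfield_rat (a : rat) : S (ratr a).
Proof. by apply: subfieldM; [|apply: subfieldV]; exact: subfield_int. Qed.

Lemma subfield_K1 {r1 x} : S zeta3 -> S r1 -> in_K1 r1 x -> S x.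
Proof.
move=> Sz Sr [a [b [c [ha hb hc ->]]]].
have Sk y : in_k y -> S y.
  by case=> d [e ->]; apply: subfieldD; [|apply: subfieldM => //]; exact: subfield_rat.
apply: subfieldD; last by apply: subfieldM; [exact: Sk | exact: subfieldX].
by apply: subfieldD; [|apply: subfieldM => //]; exact: Sk.
Qed.

End Subfield.

Lemma gen_field_cube_class (r1 r2 t t' w x : algC) :
  in_K1 r1 w -> (t ^+ 3) ^+ 2 * t' ^+ 3 = w ^+ 3 -> t != 0 ->
  gen_field [:: zeta3; r1; r2; t'] x -> gen_field [:: zeta3; r1; r2; t] x.
Proof.
move=> hw e t0 gx S hS gS; apply: gx => // g.
have Sz : S zeta3 by apply: gS; rewrite !inE eqxx.
have Sr1 : S r1 by apply: gS; rewrite !inE eqxx orbT.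
have Sr2 : S r2 by apply: gS; rewrite !inE eqxx !orbT.
have St : S t by apply: gS; rewrite !inE eqxx !orbT.
rewrite !inE => /or4P[] /eqP-> //.
have [i ei] : exists i, t ^+ 2 * t' = zeta3 ^+ i * w by apply: eq_cube; rewrite -e; ring.
have -> : t' = zeta3 ^+ i * w * (t ^+ 2)^-1 by rewrite -ei mulrAC divff ?mul1r // expf_neq0.
apply: (subfieldM S hS); last by apply: (subfieldV S hS); exact: subfieldX.
by apply: (subfieldM S hS); [exact: subfieldX | exact: (subfield_K1 S hS Sz Sr1 hw)].
Qed.

Theorem theorem4p11 (pi1 pi2 r1 : algC) (tau : algC -> algC) (P : algC -> Prop) :
  prime_Ok pi1 -> prime_Ok pi2 ->
  ~ (dvd_Ok pi1 pi2 /\ dvd_Ok pi2 pi1) ->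
  ~ dvd_Ok pi1 3 -> ~ dvd_Ok pi2 3 ->
  norm_1_mod9 pi1 -> norm_1_mod9 pi2 ->
  primary pi1 -> primary pi2 ->
  cube_in_completion pi2 pi1 -> cube_in_completion pi1 pi2 ->
  r1 ^+ 3 = pi1 ->
  is_tau r1 tau ->
  prime_ideal r1 P -> P pi2 ->
  forall theta theta' : algC,
    admissible r1 pi2 tau P theta -> admissible r1 pi2 tau P theta' ->
    forall r2 t t' : algC,
      r2 ^+ 3 = pi2 -> t ^+ 3 = theta -> t' ^+ 3 = theta' ->
      forall x : algC,
        gen_field [:: zeta3; r1; r2; t] x <-> gen_field [:: zeta3; r1; r2; t'] x.
Proof.
move=> p1 p2 p12 _ p23 _ _ prim1 prim2 cube21 _ r1E tauP hP Ppi2 theta theta' ad ad' r2 t t' _ et et' x.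
have neq0 y := @admissible_neq0 r1 pi1 tau p1 r1E tauP pi2 P p2 prim2 Ppi2 y.
have cube y y' := @admissible_cube r1 pi1 tau p1 prim1 r1E tauP pi2 P p2 p12 p23 prim2 cube21 hP Ppi2 y y'.
have t0 : t != 0 by have := neq0 _ ad; rewrite -et expf_eq0.
have t0' : t' != 0 by have := neq0 _ ad'; rewrite -et' expf_eq0.
(* Each inclusion uses the relation in its own order, since [t' = zeta3 ^ i w / t ^ 2] expresses
   only [t'] through [t]. *)
have [w [hw ew]] := cube _ _ ad ad'; have [w' [hw' ew']] := cube _ _ ad' ad.
split.
  by apply: (gen_field_cube_class _ _ _ _ w') => //; rewrite et et'.
by apply: (gen_field_cube_class _ _ _ _ w) => //; rewrite et et'.
Qed.
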